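(* Let $R$ be an order in $K$, $\mathfrak p$ a maximal ideal of $R$ and $T=(\mathfrak p:\mathfrak p)$. Let $J_1,\ldots,J_n$ be fractional $T$-ideals with multiplicator ring $T$ representing the distinct classes of $\bar W(T)$. Let $I_0$ be a fractional $R$-ideal with multiplicator ring $R$. Then there exist a fractional $R$-ideal $I$ and a unique index $i$ such that $I$ and $I_0$ are weakly equivalent, $IT=J_i$, and $\mathfrak pI=\mathfrak pJ_i\subseteq I\subseteq J_i$. Moreover, for such $I$ the inclusion $I\subseteq J_i$ induces an injection $I/\mathfrak pI\hookrightarrow J_i/\mathfrak pJ_i$ of $R/\mathfrak p$-vector spaces.
   Context: Let $Z$ be a Dedekind domain (in particular not a field) with fraction field $Q$, and let $K$ be an étale $Q$-algebra. A $Z$-lattice in $K$ is a finitely generated $Z$-submodule of $K$ containing a $Q$-basis of $K$. An order is a subring of $K$ that is a $Z$-lattice. A fractional $S$-ideal (for an order $S$) is an $S$-submodule of $K$ that is a $Z$-lattice. For $Z$-lattices $I,J$: $(I:J)=\{a\in K: aJ\subseteq I\}$ and the multiplicator ring of $I$ is $(I:I)$. For a maximal ideal $\mathfrak q$ of $S$, $S_{\mathfrak q}$ is the completion and $I_{\mathfrak q}=I\otimes_S S_{\mathfrak q}$. Fractional $S$-ideals $I,J$ are weakly equivalent if $I_{\mathfrak q}\simeq J_{\mathfrak q}$ as $S_{\mathfrak q}$-modules for all maximal ideals $\mathfrak q$ of $S$. $\bar W(S)$ is the set of weak equivalence classes of fractional $S$-ideals $I$ with $(I:I)=S$. *)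

(* Defs.v *)
From HB Require Import structures.
From mathcomp Require Import all_boot all_order all_algebra all_field.
From mathcomp Require Import ring_quotient generic_quotient fraction.
From mathcomp Require Import boolp.
From mathcomp.multinomials Require Import monalg.

Set Implicit Arguments.
Unset Strict Implicit.
Unset Printing Implicit Defensive.

Import GRing.Theory.
Local Open Scope ring_scope.
Local Open Scope quotient_scope.

(* Subsets of a ring or module are boolean predicates. Propositions are turned
   into booleans classically with `[< _ >], so every subset is represented. *)

(* [idealr A] is the type of proper ideals of A, [prime_idealr A] that of prime
   ideals. *)
Definition maximal_ideal (A : comNzRingType) (q : idealr A) : Prop :=
  forall q' : idealr A, {subset q <= q'} -> q' =i q.

(* The unit ideal, which is not an [idealr], is always finitely generated. *)
Definition noetherian (A : comNzRingType) : Prop :=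
  forall a : idealr A, exists s : seq A, forall x,
    x \in a <-> exists c : 'I_(size s) -> A, x = \sum_(i < size s) c i * s`_i.

Definition integrally_closed (Z : idomainType) : Prop :=
  forall x : {fraction Z}, integralOver (@FracField.tofrac Z) x ->
    exists z : Z, x = FracField.tofrac z.

Record dedekind (Z : idomainType) : Prop := Dedekind {
  dedekind_not_field : exists z : Z, z != 0 /\ z \isn't a GRing.unit;
  dedekind_noetherian : noetherian Z;
  dedekind_integrally_closed : integrally_closed Z;
  dedekind_dim1 : forall q : prime_idealr Z,
    (exists2 x, x \in q & x != 0) -> maximal_ideal q
}.

(* The set of finite sums of products x * y with x in P and y in N; it is the
   product of P and N when these are additive subgroups. *)
Definition prodset (A : comNzRingType) (P N : {pred A}) : {pred A} :=
  fun x => `[< exists2 s : seq (A * A),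
    forall u, u \in s -> u.1 \in P /\ u.2 \in N & x = \sum_(u <- s) u.1 * u.2 >].

Section IdealPowers.
Variables (A : comNzRingType) (q : idealr A).

(* [powset n] is the power q ^ (n + 1). *)
Fixpoint powset (n : nat) : {pred A} :=
  if n is m.+1 then prodset q (powset m) else (q : {pred A}).

Lemma powset_idealr_closed n : idealr_closed (powset n).
Proof.
elim: n => [|n [_ IH1 IH]].
  split; [exact: idealr0 | by rewrite idealr1 |].
  by move=> a u v uq vq; rewrite rpredD // idealMr.
split.
- by apply/asboolP; exists [::]; rewrite ?big_nil.
- apply/negP => /asboolP[s hs /eqP]; apply/negP; rewrite eq_sym.
  apply/eqP => e; move: (idealr1 q); rewrite -e.
  rewrite big_seq rpred_sum // => u /hs[u1 _].
  by rewrite mulrC idealMr.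
- move=> a u v /asboolP[s hs ->] /asboolP[t ht ->]; apply/asboolP.
  exists ([seq (a * w.1, w.2) | w <- s] ++ t).
    move=> w; rewrite mem_cat => /orP[/mapP[w' /hs[h1 h2] ->]|/ht //].
    by split=> //=; rewrite idealMr.
  rewrite big_cat big_map mulr_sumr; congr (_ + _).
  by apply: eq_bigr => w _; rewrite mulrA.
Qed.

HB.instance Definition _ n :=
  isIdealr.Build A (powset n) (powset_idealr_closed n).

Definition ideal_pow (n : nat) : idealr A := powset n.

End IdealPowers.

(* The inverse limit of the rings A / q ^ (n + 1), n >= 0. Two elements of
   A / q ^ (n + 1) and A / q ^ (n + 2) correspond under the transition map if
   and only if they have a common representative in A. *)
Section Completion.
Variables (A : comNzRingType) (q : idealr A).

Local Notation Aq n := {ideal_quot ideal_pow q n}.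

Record completion : Type := Completion {
  cval : forall n, Aq n;
  _ : `[< forall n, exists a : A, cval n = \pi a /\ cval n.+1 = \pi a >]
}.

HB.instance Definition _ := [isSub for cval].
HB.instance Definition _ := [Choice of completion by <:].

Lemma cvalP (x : completion) n :
  exists a : A, cval x n = \pi a /\ cval x n.+1 = \pi a.
Proof. by case: x n => x /= /asboolP. Qed.

Lemma completion_inj (x y : completion) : (forall n, cval x n = cval y n) -> x = y.
Proof. by move=> e; apply/val_inj/functional_extensionality_dep. Qed.

Fact const_coherent (a : A) : `[< forall n, exists b : A,
  \pi_(Aq n) a = \pi b /\ \pi_(Aq n.+1) a = \pi b >].
Proof. by apply/asboolP => n; exists a. Qed.
Definition completion_map (a : A) : completion :=
  Completion (const_coherent a).

Fact add_coherent (x y : completion) : `[< forall n, exists a : A,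
  cval x n + cval y n = \pi a /\ cval x n.+1 + cval y n.+1 = \pi a >].
Proof.
apply/asboolP => n; case: (cvalP x n) (cvalP y n) => a [-> ->] [b [-> ->]].
by exists (a + b); rewrite !rmorphD.
Qed.
Definition completion_add x y := Completion (add_coherent x y).

Fact opp_coherent (x : completion) : `[< forall n, exists a : A,
  - cval x n = \pi a /\ - cval x n.+1 = \pi a >].
Proof.
apply/asboolP => n; case: (cvalP x n) => a [-> ->].
by exists (- a); rewrite !rmorphN.
Qed.
Definition completion_opp x := Completion (opp_coherent x).

Fact mul_coherent (x y : completion) : `[< forall n, exists a : A,
  cval x n * cval y n = \pi a /\ cval x n.+1 * cval y n.+1 = \pi a >].
Proof.
apply/asboolP => n; case: (cvalP x n) (cvalP y n) => a [-> ->] [b [-> ->]].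
by exists (a * b); rewrite !rmorphM.
Qed.
Definition completion_mul x y := Completion (mul_coherent x y).

Fact completion_addA : associative completion_add.
Proof. by move=> x y z; apply: completion_inj => n /=; rewrite addrA. Qed.
Fact completion_addC : commutative completion_add.
Proof. by move=> x y; apply: completion_inj => n /=; rewrite addrC. Qed.
Fact completion_add0 : left_id (completion_map 0) completion_add.
Proof. by move=> x; apply: completion_inj => n /=; rewrite rmorph0 add0r. Qed.
Fact completion_addN :
  left_inverse (completion_map 0) completion_opp completion_add.
Proof. by move=> x; apply: completion_inj => n /=; rewrite addNr rmorph0. Qed.
HB.instance Definition _ := GRing.isZmodule.Build completion
  completion_addA completion_addC completion_add0 completion_addN.

Fact completion_mulA : associative completion_mul.
Proof. by move=> x y z; apply: completion_inj => n /=; rewrite mulrA. Qed.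
Fact completion_mulC : commutative completion_mul.
Proof. by move=> x y; apply: completion_inj => n /=; rewrite mulrC. Qed.
Fact completion_mul1 : left_id (completion_map 1) completion_mul.
Proof. by move=> x; apply: completion_inj => n /=; rewrite rmorph1 mul1r. Qed.
Fact completion_mulDl : left_distributive completion_mul completion_add.
Proof. by move=> x y z; apply: completion_inj => n /=; rewrite mulrDl. Qed.
Fact completion_nonzero : completion_map 1 != 0.
Proof.
apply/eqP => /(congr1 (fun x => cval x 0)) /=; rewrite rmorph1 rmorph0.
by apply/eqP; rewrite oner_eq0.
Qed.
HB.instance Definition _ := GRing.Zmodule_isComNzRing.Build completion
  completion_mulA completion_mulC completion_mul1 completion_mulDl
  completion_nonzero.

Fact completion_map_zmod : zmod_morphism completion_map.
Proof. by move=> x y; apply: completion_inj => n /=; rewrite rmorphB. Qed.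
Fact completion_map_monoid : monoid_morphism completion_map.
Proof.
by split=> // x y; apply: completion_inj => n /=; rewrite rmorphM.
Qed.
HB.instance Definition _ :=
  GRing.isZmodMorphism.Build A completion completion_map completion_map_zmod.
HB.instance Definition _ :=
  GRing.isMonoidMorphism.Build A completion completion_map completion_map_monoid.

End Completion.

Section Span.
Variables (A : comNzRingType) (V : lmodType A) (G : V -> Prop).

Definition lspan : {pred V} :=
  fun x => `[< exists2 s : seq (A * V),
    forall u, u \in s -> G u.2 & x = \sum_(u <- s) u.1 *: u.2 >].

Fact lspan_submod_closed : submod_closed lspan.
Proof.
split; first by apply/asboolP; exists [::]; rewrite ?big_nil.
move=> a u v /asboolP[s hs ->] /asboolP[t ht ->]; apply/asboolP.
exists ([seq (a * w.1, w.2) | w <- s] ++ t).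
  by move=> w; rewrite mem_cat => /orP[/mapP[w' /hs h ->]|/ht].
rewrite big_cat big_map scaler_sumr; congr (_ + _).
by apply: eq_bigr => w _; rewrite scalerA.
Qed.
HB.instance Definition _ :=
  GRing.isSubmodClosed.Build A V lspan
    (GRing.submod_closed_semi lspan_submod_closed).

End Span.

Section QuotientModule.
Variables (A : comNzRingType) (V : lmodType A) (G : V -> Prop).

Local Notation Q := {ideal_quot lspan G}.

Definition quot_mod : Type := Q.
HB.instance Definition _ := GRing.Zmodule.on quot_mod.

Definition quot_cls (v : V) : quot_mod := \pi_(Q) v.
Definition quot_scale (a : A) (x : quot_mod) : quot_mod :=
  quot_cls (a *: repr (x : Q)).

Fact quot_clsD : {morph quot_cls : u v / u + v}.
Proof. by move=> u v; rewrite /quot_cls raddfD. Qed.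
Fact quot_cls_repr (x : quot_mod) : quot_cls (repr (x : Q)) = x.
Proof. exact: reprK. Qed.
Fact quot_clsP u v : (quot_cls u = quot_cls v) <-> (u - v \in lspan G).
Proof.
rewrite Quotient.idealrBE; split=> [e|/eqP //]; exact/eqP.
Qed.
Fact quot_scaleE a v : quot_scale a (quot_cls v) = quot_cls (a *: v).
Proof.
by apply/quot_clsP; rewrite -scalerBr rpredZ //; apply/quot_clsP/quot_cls_repr.
Qed.

Fact quot_scaleA a b x : quot_scale a (quot_scale b x) = quot_scale (a * b) x.
Proof. by rewrite -[x]quot_cls_repr !quot_scaleE scalerA. Qed.
Fact quot_scale1 : left_id 1 quot_scale.
Proof. by move=> x; rewrite -[x]quot_cls_repr quot_scaleE scale1r. Qed.
Fact quot_scaleDr : right_distributive quot_scale +%R.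
Proof.
move=> a x y; rewrite -[x]quot_cls_repr -[y]quot_cls_repr.
by rewrite -quot_clsD !quot_scaleE scalerDr quot_clsD.
Qed.
Fact quot_scaleDl x : {morph quot_scale^~ x : a b / a + b}.
Proof.
by move=> a b; rewrite -[x]quot_cls_repr !quot_scaleE scalerDl quot_clsD.
Qed.
HB.instance Definition _ := GRing.Zmodule_isLmodule.Build A quot_mod
  quot_scaleA quot_scale1 quot_scaleDr quot_scaleDl.

Fact quot_cls_linear : linear quot_cls.
Proof. by move=> a u v; rewrite quot_clsD -quot_scaleE. Qed.
HB.instance Definition _ :=
  GRing.isLinear.Build A V quot_mod *:%R quot_cls quot_cls_linear.

End QuotientModule.

(* The B-module M (x)_A B, presented by the generators m (x) 1, m in M, subject
   to (x + y) (x) 1 = x (x) 1 + y (x) 1 and (a x) (x) 1 = f(a) (x (x) 1). *)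
Section ExtensionOfScalars.
Variables (A B : comNzRingType) (f : {rmorphism A -> B}) (M : lmodType A).

Definition ext_gen (m : M) : {malg B[M]} := mkmalgU m 1.

Inductive ext_rel : {malg B[M]} -> Prop :=
| ExtAdd (x y : M) : ext_rel (ext_gen (x + y) - ext_gen x - ext_gen y)
| ExtScale (a : A) (x : M) : ext_rel (ext_gen (a *: x) - f a *: ext_gen x).

Definition ext_scalars : Type := quot_mod ext_rel.
HB.instance Definition _ := GRing.Lmodule.copy ext_scalars (quot_mod ext_rel).

Definition ext_unit (m : M) : ext_scalars :=
  quot_cls ext_rel (ext_gen m).

End ExtensionOfScalars.

(* M / qM as a module over A / q. *)
Section ModIdeal.
Variables (A : comNzRingType) (q : idealr A) (M : lmodType A).

Definition ideal_smul (y : M) : Prop :=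
  exists a, exists2 x : M, a \in q & y = a *: x.

Definition mod_ideal : Type := quot_mod ideal_smul.
HB.instance Definition _ := GRing.Zmodule.on mod_ideal.

Definition mod_cls (m : M) : mod_ideal := quot_cls ideal_smul m.

Definition mod_scale (a : {ideal_quot q}) (x : mod_ideal) : mod_ideal :=
  repr a *: (x : quot_mod ideal_smul).

Fact mod_scaleE (a : A) (x : mod_ideal) :
  mod_scale (\pi_({ideal_quot q}) a) x = a *: (x : quot_mod ideal_smul).
Proof.
rewrite /mod_scale -[x]quot_cls_repr -!linearZ_LR; apply/quot_clsP.
rewrite -scalerBl; apply/asboolP.
exists [:: (1, (repr (\pi_({ideal_quot q}) a) - a) *: repr (x : {ideal_quot lspan ideal_smul}))].
  move=> u; rewrite inE => /eqP -> /=; do 2!eexists; last by [].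
  by rewrite Quotient.idealrBE reprK.
by rewrite big_seq1 scale1r.
Qed.

Fact mod_scaleA a b x : mod_scale a (mod_scale b x) = mod_scale (a * b) x.
Proof.
by rewrite -[a]reprK -[b]reprK -rmorphM !mod_scaleE scalerA.
Qed.
Fact mod_scale1 : left_id 1 mod_scale.
Proof. by move=> x; rewrite -(rmorph1 (\pi_{ideal_quot q})) mod_scaleE scale1r. Qed.
Fact mod_scaleDr : right_distributive mod_scale +%R.
Proof. by move=> a x y; rewrite /mod_scale scalerDr. Qed.
Fact mod_scaleDl x : {morph mod_scale^~ x : a b / a + b}.
Proof.
move=> a b; rewrite -[a]reprK -[b]reprK -rmorphD !mod_scaleE.
by rewrite scalerDl.
Qed.
HB.instance Definition _ := GRing.Zmodule_isLmodule.Build {ideal_quot q} mod_ideal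
  mod_scaleA mod_scale1 mod_scaleDr mod_scaleDl.

End ModIdeal.

(* Finite dimension is not part of [comAlgType], but follows from [etale]. *)

(* K is a finite product of finite separable field extensions of F. *)
Definition etale (F : fieldType) (K : comAlgType F) : Prop :=
  exists (n : nat) (L : 'I_n -> fieldExtType F),
    (forall i, separable 1%VS {:L i}%VS) /\
    exists f : forall i, {lrmorphism K -> L i},
      forall y : (forall i, L i), exists! x : K, forall i, f i x = y i.

Section Lattices.
Variables (Z : idomainType) (K : comAlgType {fraction Z}).
Implicit Types (I J : {pred K}) (S T : subringClosed K).

Definition lattice I : Prop :=
  (exists s : seq K, forall x, x \in I <->
     exists c : 'I_(size s) -> Z,
       x = \sum_(i < size s) FracField.tofrac (c i) *: s`_i) /\
  (exists (n : nat) (b : 'I_n -> K), (forall i, b i \in I) /\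
     forall x : K, exists! c : {ffun 'I_n -> {fraction Z}},
       x = \sum_(i < n) c i *: b i).

Definition is_order S : Prop := lattice S.

Definition colon I J : {pred K} :=
  fun a => `[< forall x, x \in J -> a * x \in I >].

Record subring_of S : Type := SubringOf { srval : K; _ : srval \in S }.
HB.instance Definition _ S := [isSub for @srval S].
HB.instance Definition _ S := [Choice of subring_of S by <:].
HB.instance Definition _ S := [SubChoice_isSubComNzRing of subring_of S by <:].

Record fracideal S : Type := FracIdeal {
  fi_set :> {pred K};
  fi_zmod_closed : zmod_closed fi_set;
  fi_stable : forall a x, a \in S -> x \in fi_set -> a * x \in fi_set;
  fi_lattice : lattice fi_set
}.

HB.instance Definition _ S (I : fracideal S) :=
  GRing.isZmodClosed.Build K (fi_set I) (fi_zmod_closed I).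

Record fi_elt S (I : fracideal S) : Type :=
  FiElt { fi_val : K; _ : fi_val \in fi_set I }.
HB.instance Definition _ S (I : fracideal S) := [isSub for @fi_val S I].
HB.instance Definition _ S (I : fracideal S) := [Choice of fi_elt I by <:].
HB.instance Definition _ S (I : fracideal S) :=
  [SubChoice_isSubZmodule of fi_elt I by <:].

Section FracidealModule.
Variables (S : subringClosed K) (I : fracideal S).

Definition fi_scale (a : subring_of S) (x : fi_elt I) : fi_elt I :=
  FiElt (fi_stable (valP a) (valP x)).

Fact fi_scaleA a b x : fi_scale a (fi_scale b x) = fi_scale (a * b) x.
Proof. by apply: val_inj; rewrite /= mulrA. Qed.
Fact fi_scale1 : left_id 1 fi_scale.
Proof. by move=> x; apply: val_inj; rewrite /= mul1r. Qed.
Fact fi_scaleDr : right_distributive fi_scale +%R.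
Proof. by move=> a x y; apply: val_inj; rewrite /= mulrDr. Qed.
Fact fi_scaleDl x : {morph fi_scale^~ x : a b / a + b}.
Proof. by move=> a b; apply: val_inj; rewrite /= mulrDl. Qed.
HB.instance Definition _ := GRing.Zmodule_isLmodule.Build (subring_of S)
  (fi_elt I) fi_scaleA fi_scale1 fi_scaleDr fi_scaleDl.

End FracidealModule.

(* For every maximal ideal q of S, the extensions of scalars of I and J to the
   completion of S at q are isomorphic. *)
Definition weak_equiv S (I J : fracideal S) : Prop :=
  forall q : idealr (subring_of S), maximal_ideal q ->
    exists g : {linear ext_scalars (completion_map q) (fi_elt I) ->
                       ext_scalars (completion_map q) (fi_elt J)},
      bijective g.

Section IdealInK.
Variables (S : subringClosed K) (q : idealr (subring_of S)).

Definition ideal_in : {pred K} :=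
  fun x => `[< exists2 a : subring_of S, a \in q & x = val a >].

Fact ideal_in_zmod_closed : zmod_closed ideal_in.
Proof.
split; first by apply/asboolP; exists 0; rewrite ?idealr0.
move=> u v /asboolP[a aq ->] /asboolP[b bq ->].
by apply/asboolP; exists (a - b); rewrite ?rpredB.
Qed.
HB.instance Definition _ :=
  GRing.isZmodClosed.Build K ideal_in ideal_in_zmod_closed.

Fact multring_subring_closed : subring_closed (colon ideal_in ideal_in).
Proof.
split.
- by apply/asboolP => x; rewrite mul1r.
- move=> u v /asboolP hu /asboolP hv; apply/asboolP => x xq.
  by rewrite mulrBl rpredB ?hu ?hv.
- move=> u v /asboolP hu /asboolP hv; apply/asboolP => x xq.
  by rewrite -mulrA hu ?hv.
Qed.

Definition multring_pred : {pred K} := colon ideal_in ideal_in.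
HB.instance Definition _ :=
  GRing.isSubringClosed.Build K multring_pred multring_subring_closed.

(* The ring (q : q). *)
Definition multring : subringClosed K := multring_pred.

Fact sub_multring : {subset S <= multring}.
Proof.
move=> a aS; apply/asboolP => x /asboolP[b bq ->].
by apply/asboolP; exists (SubringOf aS * b); rewrite ?idealMr.
Qed.

End IdealInK.

(* A fractional T-ideal regarded as a fractional S-ideal, for S inside T. *)
Definition fi_restrict S T (sST : {subset S <= T}) (I : fracideal T) :
    fracideal S :=
  FracIdeal (fi_zmod_closed I)
    (fun a x aS xI => fi_stable (sST a aS) xI) (fi_lattice I).

End Lattices.

Arguments sub_multring {Z K S} q.

(* Main.v *)
(* Local isomorphism over completions is equivalent to the global condition
   1 \in (I : J) (J : I). One direction is functoriality of the extension of
   scalars. For the other, clear denominators: if d in Z satisfies dI, dJ <= S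
   and d \in I, then a map phi : I -> J that is linear modulo q^n differs, after
   multiplication by some s outside q with s q^n <= d^8 S, by a small error from
   multiplication by s phi(d) / d \in (J : I). Treating an isomorphism of
   completions and its inverse in this way gives two multipliers whose product
   is s^2 up to an element of (I : J) (J : I), so this ideal is not inside q.

   For the theorem, (I0 T : I0 T) = T, so I0 T is weakly equivalent to a unique
   J_i. The T-ideal L = (J_i : I0 T) is invertible and T / p is finite over the
   field R / p, so L = x T + p L for some x. Then x R + p L is an invertible
   fractional R-ideal extending to L, and I := x I0 + p J_i. *)
Require Import Defs.
From HB Require Import structures.
From mathcomp Require Import all_boot all_order all_algebra all_field.
From mathcomp Require Import ring_quotient generic_quotient fraction.
From mathcomp Require Import finmap boolp classical_sets ring.
From mathcomp.multinomials Require Import monalg.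

Set Implicit Arguments.
Unset Strict Implicit.
Unset Printing Implicit Defensive.

Import GRing.Theory.
Local Open Scope ring_scope.
Local Open Scope quotient_scope.

(** * Extension of scalars *)

(** No structure theory of completions is used: [ext_residue] reduces a completed module to the
    single level [A / q^(n+1)], and the rest takes place inside [K]. The kernel of
    [completion q -> A / q^(n+1)] is never described by generators; error terms are carried instead
    as sums with coefficients in that kernel, a shape that every linear map over the completion
    preserves. One level suffices because a power of [q] becomes divisible by any given nonzero [z]
    of [Z] after multiplication by some [s] outside [q]; this is where dimension one enters, through
    primes of [S] containing [z]. Over [R], the generator [x] of [L] is found together with a
    partner [x'] in the inverse of [L] such that [x x' - 1] lies in [p]. Invertibility of
    [x R + p L] and the equality [IT = J_i] then become identities in [x], [x'] and [pi = x x' - 1].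
    The equality [pI = pJ_i] comes from [pT = p]. *)

Section ExtScalars.
Variables (A B : comNzRingType) (f : {rmorphism A -> B}) (M : lmodType A).

Lemma ext_unitD (x y : M) : ext_unit f (x + y) = ext_unit f x + ext_unit f y.
Proof.
apply/eqP; rewrite -subr_eq0 opprD addrA -!raddfB -(raddf0 (quot_cls _)).
apply/eqP/quot_clsP; rewrite subr0; apply/asboolP.
exists [:: (1, ext_gen B (x + y) - ext_gen B x - ext_gen B y)].
  by move=> u; rewrite inE => /eqP -> /=; exact: ExtAdd.
by rewrite big_seq1 scale1r.
Qed.

Lemma ext_unitZ a (x : M) : ext_unit f (a *: x) = f a *: ext_unit f x.
Proof.
rewrite /ext_unit -linearZ; apply/quot_clsP; apply/asboolP.
exists [:: (1, ext_gen B (a *: x) - f a *: ext_gen B x)].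
  by move=> u; rewrite inE => /eqP -> /=; exact: ExtScale.
by rewrite big_seq1 scale1r.
Qed.

Lemma ext_decomp (x : ext_scalars f M) :
  exists s : seq (B * M), x = \sum_(u <- s) u.1 *: ext_unit f u.2.
Proof.
rewrite -[x]quot_cls_repr; move: (repr _) => g.
exists [seq (g@_k, k) | k <- msupp g].
rewrite big_map [in LHS](monalgE g) raddf_sum; apply: eq_bigr => k _ /=.
rewrite /ext_unit -linearZ; congr quot_cls; apply/malgP => k'.
by rewrite mcoeffZ !mcoeffU mulrnAr mulr1.
Qed.

(** The target is only an abelian group because it will be a [B]-module in [ext_map] but a module
    over [A / q^(n+1)] in [ext_residue]. *)
Lemma ext_lift (W : zmodType) (h : B -> M -> W) :
    (forall m, {morph h^~ m : b c / b + c}) ->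
    (forall b, {morph h b : m l / m + l}) ->
    (forall b a m, h (f a * b) m = h b (a *: m)) ->
  exists2 H : ext_scalars f M -> W, {morph H : x y / x + y} &
    forall b m, H (b *: ext_unit f m) = h b m.
Proof.
move=> hB hM hZ; have h0 m : h 0 m = 0.
  by apply: (addrI (h 0 m)); rewrite -hB !addr0.
pose F (g : {malg B[M]}) := \sum_(k <- msupp g) h g@_k k.
have FE (d : {fset M}) g : (msupp g `<=` d)%fset -> F g = \sum_(k <- d) h g@_k k.
  move=> le; rewrite /F (big_fset_incl _ le) //= => k _ /mcoeff_outdom ->.
  by rewrite h0.
have FD : {morph F : x y / x + y}.
  move=> x y; pose d := (msupp x `|` msupp y)%fset.
  rewrite !(@FE d) ?fsubsetUl ?fsubsetUr ?msuppD_le // -big_split /=.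
  by apply: eq_bigr => k _; rewrite mcoeffD hB.
have F0 : F 0 = 0 by apply: (addrI (F 0)); rewrite -FD !addr0.
have FN x : F (- x) = - F x by apply: (addrI (F x)); rewrite -FD !subrr F0.
have FU b m : F (b *: ext_gen B m) = h b m.
  rewrite (FE [fset m]%fset) ?big_seq_fset1 ?mcoeffZ ?mcoeffUU ?mulr1 //.
  by apply: fsubset_trans (msuppZ_le _ _) msuppU_le.
have Flspan x : x \in lspan (ext_rel f (M:=M)) -> F x = 0.
  move=> /asboolP[s hs ->]; elim: s hs => [|u s IH] hs; first by rewrite big_nil.
  rewrite big_cons FD IH ?addr0; last by move=> v vs; apply: hs; rewrite inE vs orbT.
  have {hs} := hs _ (mem_head u s); case: u => b v /= [x1 y1|a x1].
    by rewrite !scalerBr !FD !FN !FU hM addrAC addrK subrr.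
  by rewrite scalerBr scalerA FD FN !FU mulrC hZ subrr.
have Fcls x y : quot_cls (ext_rel f (M:=M)) x = quot_cls _ y -> F x = F y.
  move=> /quot_clsP /Flspan; rewrite FD FN => /eqP.
  by rewrite subr_eq0 => /eqP.
exists (fun x => F (repr (x : {ideal_quot lspan (ext_rel f (M:=M))}))).
  move=> x y; rewrite -FD; apply: Fcls.
  by rewrite quot_clsD !quot_cls_repr.
move=> b m; rewrite -FU; apply: Fcls; rewrite quot_cls_repr.
by rewrite linearZ.
Qed.

End ExtScalars.

Lemma ext_map (A B : comNzRingType) (f : {rmorphism A -> B}) (M N : lmodType A)
    (phi : {linear M -> N}) :
  exists g : {linear ext_scalars f M -> ext_scalars f N},
    forall b m, g (b *: ext_unit f m) = b *: ext_unit f (phi m).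
Proof.
have [|||H HD HU] := @ext_lift A B f M (ext_scalars f N)
  (fun b m => b *: ext_unit f (phi m)).
- by move=> m b c; rewrite scalerDl.
- by move=> b m l; rewrite linearD ext_unitD scalerDr.
- by move=> b a m; rewrite linearZ ext_unitZ scalerA mulrC.
have H0 : H 0 = 0 by apply: (addrI (H 0)); rewrite -HD !addr0.
have HZ b x : H (b *: x) = b *: H x.
  have [s ->] := ext_decomp x; rewrite scaler_sumr.
  elim: s => [|u s IH]; first by rewrite !big_nil H0 scaler0.
  by rewrite !big_cons !HD IH scalerDr !scalerA !HU scalerA.
have lH : linear H by move=> b x y; rewrite HD HZ.
pose mx := GRing.isLinear.Build B _ _ _ H lH.
pose g : {linear _ -> _} := HB.pack H mx.
by exists g => b m; apply: HU.
Qed.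

(** Both composites extend to multiplication by the unit [f a], so dividing the extension of [psi]
    by it gives the inverse. *)
Lemma ext_map_bij (A B : comNzRingType) (f : {rmorphism A -> B})
    (M N : lmodType A) (phi : {linear M -> N}) (psi : {linear N -> M}) a y :
    f a * y = 1 -> (forall m, psi (phi m) = a *: m) ->
    (forall n, phi (psi n) = a *: n) ->
  exists g : {linear ext_scalars f M -> ext_scalars f N}, bijective g.
Proof.
move=> ay psiK phiK.
have [G GE] := ext_map f phi; have [H HE] := ext_map f psi.
have HG x : H (G x) = f a *: x.
  have [t ->] := ext_decomp x; rewrite scaler_sumr !linear_sum.
  by apply: eq_bigr => w _; rewrite /= GE HE psiK ext_unitZ !scalerA mulrC.
have GH x : G (H x) = f a *: x.
  have [t ->] := ext_decomp x; rewrite scaler_sumr !linear_sum.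
  by apply: eq_bigr => w _; rewrite /= HE GE phiK ext_unitZ !scalerA mulrC.
exists G; exists (fun x => y *: H x) => x.
  by rewrite HG scalerA mulrC ay scale1r.
by rewrite linearZ_LR GH scalerA mulrC ay scale1r.
Qed.

(** * Units of the completion and local isomorphisms *)

Lemma idealr_of_closed (A : comNzRingType) (P : {pred A}) :
  idealr_closed P -> exists q : idealr A, q =i P.
Proof.
move=> h; pose mx := isIdealr.Build A P h.
by pose q : idealr A := HB.pack P mx; exists q.
Qed.

Lemma maximal_ideal_inv (A : comNzRingType) (q : idealr A) a :
  maximal_ideal q -> a \notin q -> exists r, 1 - a * r \in q.
Proof.
move=> mq aq; apply: contrapT => /forallNP h.
pose P : {pred A} := fun x => `[< exists r, x - a * r \in q >].
have [|q' q'E] := @idealr_of_closed A P.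
  split.
  - by apply/asboolP; exists 0; rewrite mulr0 subrr idealr0.
  - by apply/negP => /asboolP[r]; apply: h.
  - move=> c u v /asboolP[r hr] /asboolP[t ht]; apply/asboolP.
    exists (c * r + t).
    have -> : c * u + v - a * (c * r + t) = c * (u - a * r) + (v - a * t) by ring.
    by rewrite rpredD // idealMr.
have sub : {subset q <= q'}.
  by move=> x xq; rewrite q'E; apply/asboolP; exists 0; rewrite mulr0 subr0.
case/negP: aq; rewrite -(mq q' sub) q'E; apply/asboolP; exists 1.
by rewrite mulr1 subrr idealr0.
Qed.

Lemma maximal_ideal_prime (A : comNzRingType) (q : idealr A) u v :
  maximal_ideal q -> u \notin q -> v \notin q -> u * v \notin q.
Proof.
move=> mq uq vq; apply/negP => uvq.
have [r hr] := maximal_ideal_inv mq uq.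
case/negP: vq; rewrite -[v]mul1r -(subrK (u * r) 1) mulrDl rpredD //.
  by rewrite mulrC idealMr.
by rewrite mulrAC mulrC idealMr.
Qed.

Lemma powset_exp (A : comNzRingType) (q : idealr A) t n :
  t \in q -> t ^+ n.+1 \in ideal_pow q n.
Proof.
move=> tq; elim: n => [//|n IH]; apply/asboolP; exists [:: (t, t ^+ n.+1)].
  by move=> u; rewrite inE => /eqP ->.
by rewrite big_seq1 exprS.
Qed.

(** Geometric series: with [t = 1 - s * r] in [q], the inverse of [s] is [r * (1 + t + t^2 + ...)].
    Level [n] is the quotient by [q^(n+1)], hence the [n+1] terms. *)
Lemma completion_map_unit (A : comNzRingType) (q : idealr A) s :
  maximal_ideal q -> s \notin q -> exists y, completion_map q s * y = 1.
Proof.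
move=> mq /(maximal_ideal_inv mq)[r tq]; set t := 1 - s * r in tq.
pose v n := r * \sum_(i < n.+1) t ^+ i.
have coh : `[< forall n, exists a : A,
    \pi_({ideal_quot ideal_pow q n}) (v n) = \pi a /\
    \pi_({ideal_quot ideal_pow q n.+1}) (v n.+1) = \pi a >].
  apply/asboolP => n; exists (v n.+1); split=> //; apply/eqP.
  rewrite -Quotient.idealrBE /v [X in _ - _ * X]big_ord_recr /= mulrDr opprD.
  by rewrite addrA subrr add0r rpredN idealMr // powset_exp.
exists (Completion coh); apply: completion_inj => n /=.
rewrite -rmorphM; apply/eqP; rewrite -Quotient.idealrBE.
have -> : s * v n - 1 = - t ^+ n.+1.
  have -> : - t ^+ n.+1 = 1 - t ^+ n.+1 - 1 by ring.
  have -> : 1 - t ^+ n.+1 = (1 - t) * \sum_(i < n.+1) t ^+ i.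
    by rewrite -opprB subrX1 -mulNr opprB.
  by rewrite subKr mulrA.
by rewrite rpredN powset_exp.
Qed.

Section LocalIso.
Variables (Z : idomainType) (K : comAlgType {fraction Z}) (S : subringClosed K).
Implicit Types I J : fracideal S.

Lemma colon_linear I J b : b \in colon J I ->
  exists phi : {linear fi_elt I -> fi_elt J}, forall x, val (phi x) = b * val x.
Proof.
move=> /asboolP hb.
pose h (x : fi_elt I) : fi_elt J := FiElt (hb (val x) (valP x)).
have lh : linear h.
  by move=> a x y; apply: val_inj; rewrite /= mulrDr mulrCA.
pose mx := GRing.isLinear.Build (subring_of S) _ _ _ h lh.
pose g : {linear _ -> _} := HB.pack h mx.
by exists g.
Qed.

(** The products in a decomposition of 1 cannot all lie in [q]. The factors of one that does not
    give maps [I -> J] and [J -> I] whose composites become a unit of the completion. *)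
Lemma weak_equiv_colon I J :
  colon J J =i S -> 1 \in prodset (colon I J) (colon J I) -> weak_equiv I J.
Proof.
move=> hJ /asboolP[s hs e1] q mq.
have [[u us nq]|hq] := pselect (exists2 u, u \in s &
    u.1 * u.2 \notin ideal_in q); last first.
  have : 1 \in ideal_in q.
    rewrite e1 big_seq rpred_sum // => u us.
    by apply/negPn/negP => nq; apply: hq; exists u.
  move=> /asboolP[a aq e]; move: (idealr1 q).
  by rewrite (_ : 1 = a) ?aq //; apply: val_inj.
have [u1 u2] := hs u us.
have uS : u.1 * u.2 \in S.
  rewrite -hJ; apply/asboolP => x xJ.
  rewrite [u.1 * _]mulrC -mulrA.
  by move: u1 u2 => /asboolP u1 /asboolP u2; apply/u2/u1.
pose a : subring_of S := SubringOf uS.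
have aq : a \notin q by apply: contra nq => aq; apply/asboolP; exists a.
have [y ya] := completion_map_unit mq aq.
have [phi phiE] := colon_linear u2; have [psi psiE] := colon_linear u1.
apply: (ext_map_bij (phi := phi) (psi := psi) ya) => x; apply: val_inj.
  by rewrite psiE phiE mulrA.
by rewrite phiE psiE mulrA [_ * u.1]mulrC.
Qed.

End LocalIso.

(** * Isomorphisms of completions modulo a power of the ideal *)

Lemma mod_clsP (A : comNzRingType) (q : idealr A) (M : lmodType A) (x y : M) :
  mod_cls q x = mod_cls q y <-> x - y \in lspan (ideal_smul q (M:=M)).
Proof. exact: quot_clsP. Qed.

Lemma mod_clsZ (A : comNzRingType) (q : idealr A) (M : lmodType A) a (x : M) :
  mod_cls q (a *: x) = \pi_({ideal_quot q}) a *: mod_cls q x.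
Proof. by apply/esym/(etrans (mod_scaleE _ _)); apply: quot_scaleE. Qed.

Section Approximation.
Variables (A : comNzRingType) (q : idealr A) (n : nat).
Local Notation B := (completion q).
Local Notation f := (completion_map q).
Local Notation qn := (ideal_pow q n).

(** Reduction of the completed module modulo [q^(n+1)], semilinear along
    [completion q -> A / q^(n+1)]. *)
Lemma ext_residue (M : lmodType A) :
  exists H : ext_scalars f M -> mod_ideal qn M,
    [/\ {morph H : x y / x + y}, forall b x, H (b *: x) = cval b n *: H x &
        forall m, H (ext_unit f m) = mod_cls qn m].
Proof.
have [|||H HD HU] := @ext_lift A B f M (mod_ideal qn M)
  (fun b m => cval b n *: mod_cls qn m).
- by move=> m b c; apply: scalerDl.
- by move=> b x y; rewrite -scalerDr /mod_cls quot_clsD.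
- by move=> b a m; rewrite mod_clsZ scalerA mulrC.
exists H; split=> [//|b x|m]; last first.
  by rewrite -[ext_unit _ _]scale1r HU (_ : cval 1 n = 1) ?scale1r //= rmorph1.
have H0 : H 0 = 0 by apply: (addrI (H 0)); rewrite -HD !addr0.
have [s ->] := ext_decomp x.
elim: s => [|u s IH]; first by rewrite !big_nil scaler0 H0 scaler0.
rewrite big_cons; set y := \sum_(_ <- s) _ in IH *; move: y IH => y IH.
rewrite (HD _ y) [RHS]scalerDr -IH [in LHS]scalerDr (HD _ (b *: y)).
apply: (congr1 (fun z => z + H (b *: y))).
apply: etrans (congr1 H (scalerA b u.1 (ext_unit f u.2))) _.
apply: etrans (HU _ _) _; apply: etrans _ (congr1 _ (esym (HU u.1 u.2))).
exact/esym/(scalerA (cval b n) (cval u.1 n) (mod_cls qn u.2)).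
Qed.

(** Each coefficient agrees at level [n] with the image of an element of [A]. The remainder stays an
    explicit sum so that it can be pushed through linear maps. *)
Lemma ext_near (M : lmodType A) (x : ext_scalars f M) :
  exists m, exists2 s : seq (B * M), forall u, u \in s -> cval u.1 n = 0 &
    x = ext_unit f m + \sum_(u <- s) u.1 *: ext_unit f u.2.
Proof.
have [t ->] := ext_decomp x; elim: t => [|[b m] t [m' [s s0 IH]]].
  exists 0; exists [::] => //; rewrite !big_nil [RHS]addr0.
  by apply: (addrI (ext_unit f (0 : M))); rewrite -ext_unitD [LHS]addr0 (addr0 (0 : M)).
rewrite big_cons /= {}IH; have [a [ba _]] := cvalP b n.
exists (a *: m + m'); exists ((b - f a, m) :: s).
  move=> u; rewrite inE => /orP[/eqP -> /=|/s0 //].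
  by rewrite ba subrr.
rewrite big_cons /= ext_unitD ext_unitZ scalerBl addrACA.
by congr (_ + _); rewrite addrC subrK.
Qed.

(** [phi x] is a chosen representative of [g (ext_unit f x)] modulo [q^(n+1)], and [psi] is obtained
    likewise from [h]. Being choices, they are mere functions, compatible with scalars only up to
    [q^(n+1)]. *)
Lemma ext_iso_approx (M N : lmodType A)
    (g : {linear ext_scalars f M -> ext_scalars f N})
    (h : {linear ext_scalars f N -> ext_scalars f M}) : cancel h g ->
  exists phi : M -> N, exists psi : N -> M,
  [/\ forall a x, phi (a *: x) - a *: phi x \in lspan (ideal_smul qn (M:=N)),
      forall a y, psi (a *: y) - a *: psi y \in lspan (ideal_smul qn (M:=M)) &
      forall y, phi (psi y) - y \in lspan (ideal_smul qn (M:=N))].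
Proof.
move=> hK; have [rM [MD MZ MU]] := ext_residue M.
have [rN [ND NZ NU]] := ext_residue N.
have zero (L L' : lmodType A) (k : {linear ext_scalars f L -> ext_scalars f L'})
    (r : ext_scalars f L' -> mod_ideal qn L') (s : seq (B * L)) :
    {morph r : x y / x + y} -> (forall b x, r (b *: x) = cval b n *: r x) ->
    (forall u, u \in s -> cval u.1 n = 0) ->
    r (k (\sum_(u <- s) u.1 *: ext_unit f u.2)) = 0.
  move=> rD rZ; elim: s => [_|u s IH s0].
    by rewrite big_nil linear0; apply: (addrI (r 0)); rewrite -rD !addr0.
  rewrite big_cons linearD rD IH => [|v vs]; last by apply: s0; rewrite inE vs orbT.
  by rewrite linearZ_LR rZ s0 ?mem_head // scale0r addr0.
have near (L L' : lmodType A) (k : {linear ext_scalars f L -> ext_scalars f L'})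
    (r : ext_scalars f L' -> mod_ideal qn L') :
    {morph r : x y / x + y} -> (forall b x, r (b *: x) = cval b n *: r x) ->
    (forall m, r (ext_unit f m) = mod_cls qn m) ->
    exists p : L -> L', forall x, mod_cls qn (p x) = r (k (ext_unit f x)) /\
       exists2 s : seq (B * L'), forall u, u \in s -> cval u.1 n = 0 &
         k (ext_unit f x) =
           ext_unit f (p x) + \sum_(u <- s) u.1 *: ext_unit f u.2.
  move=> rD rZ rU.
  suff /boolp.choice : forall x, exists m : L',
      mod_cls qn m = r (k (ext_unit f x)) /\
       exists2 s : seq (B * L'), forall u, u \in s -> cval u.1 n = 0 &
         k (ext_unit f x) = ext_unit f m + \sum_(u <- s) u.1 *: ext_unit f u.2.
    by case=> p hp; exists p.
  move=> x; have [m [s s0 e]] := ext_near (k (ext_unit f x)).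
  exists m; split; last by exists s.
  rewrite [in RHS]e rD rU; have := zero _ _ idfun r s rD rZ s0.
  by rewrite /= => ->; rewrite addr0.
have [phi phiE] := near _ _ g rN ND NZ NU.
have [psi psiE] := near _ _ h rM MD MZ MU.
exists phi; exists psi; split=> [a x|a y|y]; apply/mod_clsP.
- rewrite mod_clsZ !(proj1 (phiE _)) ext_unitZ linearZ_LR NZ.
  by congr (_ *: _).
- rewrite mod_clsZ !(proj1 (psiE _)) ext_unitZ linearZ_LR MZ.
  by congr (_ *: _).
- have [_ [s s0 e]] := psiE y.
  rewrite (proj1 (phiE _)) -NU -[in RHS](hK (ext_unit f y)) [in RHS]e.
  by rewrite linearD ND (zero _ _ g rN s ND NZ s0) addr0.
Qed.

End Approximation.

(** * Ideals and finitely generated modules over Z *)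

(** Zorn's lemma, used twice: [M = {1}] gives maximal ideals, the set of all [s * x^k] gives the
    prime of [local_power_divisible]. *)
Lemma ideal_avoiding (A : comNzRingType) (M : A -> Prop) (a : A -> Prop) :
    M 1 -> (forall x y, M x -> M y -> M (x * y)) ->
    a 0 -> (forall c u v, a u -> a v -> a (c * u + v)) ->
    (forall x, a x -> ~ M x) ->
  exists P : idealr A, [/\ forall x, a x -> x \in P,
    forall x, x \in P -> ~ M x &
    forall x, x \notin P -> exists y, exists2 m, M m & m - x * y \in P].
Proof.
move=> M1 MM a0 aL aM.
(* Candidates [X] need only become ideals after adjoining [a]: the union of the empty chain is empty
   and must qualify too. *)
pose U (X : set A) := fun x => X x \/ a x.
pose G (X : set A) := (forall c u v, U X u -> U X v -> U X (c * u + v)) /\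
  (forall x, U X x -> ~ M x).
have [|X [[XL XM] Xmax]] := @Zorn_bigcup A G.
  move=> F FG Ftot; split=> [c u v|x]; last first.
    by move=> [[Y FY Yx]|/aM //]; apply: (FG Y FY).2; left.
  have sub Y x : F Y -> U Y x -> U (\bigcup_(Y in F) Y)%classic x.
    by move=> FY [Yx|ax]; [left; exists Y | right].
  move=> [[Y FY Yu]|au] [[Y' FY' Yv]|av].
  - case: (Ftot _ _ FY FY') => le.
      by apply: (sub Y') => //; apply: (FG Y' FY').1; left => //; apply: le.
    by apply: (sub Y) => //; apply: (FG Y FY).1; left => //; apply: le.
  - by apply: (sub Y) => //; apply: (FG Y FY).1; [left|right].
  - by apply: (sub Y') => //; apply: (FG Y' FY').1; [right|left].
  - by right; apply: aL.
have [|P PE] := @idealr_of_closed A (fun x => `[< U X x >]).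
  split; first by apply/asboolP; right.
    by apply/negP => /asboolP /XM.
  by move=> c u v /asboolP hu /asboolP hv; apply/asboolP/XL.
exists P; split=> [x ax|x|x].
- by rewrite PE; apply/asboolP; right.
- by rewrite PE => /asboolP /XM.
rewrite PE => /asboolP xX; apply: contrapT => h.
pose Y : set A := fun z => exists r, U X (z - x * r).
have XY z : U X z -> Y z by move=> Xz; exists 0; rewrite mulr0 subr0.
apply: (Xmax Y).
  split; first by move=> z Xz; apply: XY; left.
  move=> /(_ x) le; apply: xX; left; apply: le; exists 1.
  by rewrite mulr1 subrr; right.
have UY z : U Y z -> Y z by move=> [//|az]; apply: XY; right.
split=> [c u v /UY [r hr] /UY [t ht]|m /UY [r hr] mM].
  left; exists (c * r + t).
  have -> : c * u + v - x * (c * r + t) = c * (u - x * r) + (v - x * t) by ring.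
  exact: XL.
by apply: h; exists r; exists m => //; rewrite PE; apply/asboolP.
Qed.

Lemma maximal_ideal_containing (A : comNzRingType) (a : A -> Prop) :
    a 0 -> (forall c u v, a u -> a v -> a (c * u + v)) -> ~ a 1 ->
  exists2 q : idealr A, maximal_ideal q & forall x, a x -> x \in q.
Proof.
move=> a0 aL a1.
have [|||P [aP PM Pmax]] := @ideal_avoiding A (fun x => x = 1) a _ _ a0 aL.
- by [].
- by move=> x y -> ->; rewrite mulr1.
- by move=> x ax x1; apply: a1; rewrite -x1.
exists P => // q' sub x; apply/idP/idP => [xq|]; last exact: sub.
apply/negPn/negP => /Pmax [y [_ ->]] /sub h.
by move: (idealr1 q'); rewrite -(subrK (x * y) 1) rpredD // mulrC idealMr.
Qed.

Section ZSpan.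
Variables (Z : idomainType) (A : comNzRingType) (e : {rmorphism Z -> A}).

(** Peeling off one generator at a time suits induction on the list; [zspan_sum] recovers indexed
    sums. *)
Fixpoint zspan (s : seq A) : A -> Prop :=
  if s is x :: t then fun y => exists c, zspan t (y - e c * x) else fun y => y = 0.

Lemma zspanL s c x y : zspan s x -> zspan s y -> zspan s (e c * x + y).
Proof.
elim: s x y => [x y -> ->|g s IH x y [a ha] [b hb]] /=.
  by rewrite mulr0 addr0.
exists (c * a + b); rewrite rmorphD rmorphM.
have -> : e c * x + y - (e c * e a + e b) * g =
          e c * (x - e a * g) + (y - e b * g) by ring.
exact: IH.
Qed.

Lemma zspan0 s : zspan s 0.
Proof. by elim: s => //= g s IH; exists 0; rewrite rmorph0 mul0r subr0. Qed.

Lemma zspanB s x y : zspan s x -> zspan s y -> zspan s (x - y).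
Proof.
by move=> hx hy; rewrite addrC -mulN1r -(rmorphN1 e); apply: zspanL.
Qed.

Lemma zspan_mem s x : x \in s -> zspan s x.
Proof.
elim: s => //= g s IH; rewrite inE => /orP[/eqP ->|/IH h].
  by exists 1; rewrite rmorph1 mul1r subrr; apply: zspan0.
by exists 0; rewrite rmorph0 mul0r subr0.
Qed.

Lemma zspan_ind (P : A -> Prop) s :
    P 0 -> (forall c x y, P x -> P y -> P (e c * x + y)) ->
    (forall x, x \in s -> P x) -> forall y, zspan s y -> P y.
Proof.
move=> P0 PL; elim: s => [_ y -> //|g s IH hs y [c hc]].
rewrite -(subrK (e c * g) y) addrC; apply: PL; first by apply: hs; rewrite mem_head.
by apply: IH hc => x xs; apply: hs; rewrite inE xs orbT.
Qed.

Lemma zspan_cat s t y :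
  zspan (s ++ t) y <-> exists2 x, zspan s x & zspan t (y - x).
Proof.
elim: s y => [|g s IH] y /=.
  by split=> [h|[x -> //]]; [exists 0 => //|]; rewrite subr0.
split=> [[c /IH[x hx ht]]|[x [c hc] ht]].
  exists (e c * g + x); last by rewrite opprD addrA.
  by exists c; rewrite addrAC subrr add0r.
exists c; apply/IH; exists (x - e c * g) => //.
by rewrite opprB addrA subrK.
Qed.

Lemma zspan_sum (s : seq A) y :
  zspan s y <-> exists c : 'I_(size s) -> Z, y = \sum_(i < size s) e (c i) * s`_i.
Proof.
elim: s y => [|g s IH] y /=.
  split=> [->|[c ->]]; last by rewrite big_ord0.
  by exists (fun _ => 0); rewrite big_ord0.
split=> [[c /IH [d hd]]|[c ->]].
  exists (fun i => if unlift ord0 i is Some j then d j else c).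
  rewrite big_ord_recl unlift_none /= -(subrK (e c * g) y) addrC hd.
  by congr (_ + _); apply: eq_bigr => i _; rewrite liftK.
exists (c ord0); apply/IH; exists (fun i => c (lift ord0 i)).
by rewrite big_ord_recl /= addrAC subrr add0r.
Qed.

End ZSpan.

Section Noetherian.
Variables (Z : idomainType) (noethZ : noetherian Z).

Lemma noetherian_ideal (a : Z -> Prop) :
    a 0 -> (forall c x y, a x -> a y -> a (c * x + y)) ->
  exists s : seq Z, forall x, a x <-> zspan (@idfun Z : {rmorphism Z -> Z}) s x.
Proof.
move=> a0 aL; have [a1|a1] := pselect (a 1).
  exists [:: 1] => x; split=> _; first by exists x; rewrite /= mulr1 subrr.
  by rewrite -[x]mulr1 -[x * 1]addr0; apply: aL.
have [|q qE] := @idealr_of_closed Z (fun x => `[< a x >]).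
  split; [exact/asboolP | by apply/negP => /asboolP |].
  by move=> c u v /asboolP hu /asboolP hv; apply/asboolP/aL.
have [s hs] := noethZ q; exists s => x.
rewrite zspan_sum -hs qE; split=> [h|/asboolP //]; exact/asboolP.
Qed.

(** The coefficients at the first generator form an ideal. Lifts to [N] of its generators, together
    with generators of the part of [N] inside the span of the tail, generate [N]. *)
Lemma zspan_noetherian (A : comNzRingType) (e : {rmorphism Z -> A}) s
    (N : A -> Prop) :
    N 0 -> (forall c x y, N x -> N y -> N (e c * x + y)) ->
    (forall x, N x -> zspan e s x) ->
  exists t, forall x, N x <-> zspan e t x.
Proof.
elim: s N => [|g s IH] N N0 NL Ns.
  by exists [::] => x; split=> [/Ns|->].
pose a c := exists2 y, N y & zspan e s (y - e c * g).
have [||w wE] := @noetherian_ideal a.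
- by exists 0 => //; rewrite rmorph0 mul0r subr0; apply: zspan0.
- move=> c x y [u Nu hu] [v Nv hv]; exists (e c * u + v); first exact: NL.
  rewrite rmorphD rmorphM.
  have -> : e c * u + v - (e c * e x + e y) * g =
            e c * (u - e x * g) + (v - e y * g) by ring.
  exact: zspanL.
have [||x [_ //]|t tE] := IH (fun x => N x /\ zspan e s x).
- by split=> //; apply: zspan0.
- by move=> c x y [Nx hx] [Ny hy]; split; [apply: NL|apply: zspanL].
have : exists l : seq A, (forall y, y \in l -> N y) /\
    forall c, zspan (@idfun Z : {rmorphism Z -> Z}) w c ->
      exists2 y, zspan e l y & zspan e s (y - e c * g).
  have {wE}: forall c, c \in w -> a c by move=> c cw; apply/wE/zspan_mem.
  elim: w => [|c w IHw] hw.
    exists [::]; split=> // c ->; exists 0 => //.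
    by rewrite rmorph0 mul0r subr0; apply: zspan0.
  have [|l [lN hl]] := IHw; first by move=> b bw; apply: hw; rewrite inE bw orbT.
  have [y Ny hy] := hw c (mem_head _ _).
  exists (y :: l); split.
    by move=> z; rewrite inE => /orP[/eqP ->|/lN].
  move=> b [k /hl [z hz hb]]; exists (e k * y + z).
    by exists k; rewrite addrAC subrr add0r.
  have -> : e k * y + z - e b * g =
      e k * (y - e c * g) + (z - e (b - k * c) * g).
    by rewrite rmorphB rmorphM; ring.
  exact: zspanL.
move=> [l [lN hl]].
have lsub y : zspan e l y -> N y.
  by apply: zspan_ind => //; apply: NL.
exists (l ++ t) => y; rewrite zspan_cat; split=> [Ny|[x /lsub Nx /tE[Nyx _]]].
  have /wE/hl : a (projT1 (cid (Ns y Ny))).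
    by exists y => //; exact: projT2 (cid (Ns y Ny)).
  have := projT2 (cid (Ns y Ny)); move: (projT1 _) => c hc [x hx hxc].
  exists x => //; apply/tE; split.
    by rewrite addrC -mulN1r -(rmorphN1 e); apply: NL => //; apply: lsub.
  have -> : y - x = (y - e c * g) - (x - e c * g) by ring.
  exact: zspanB.
by rewrite -(subrK x y) -[_ - _]mul1r -(rmorph1 e); apply: NL.
Qed.

End Noetherian.

(** * Finite algebras over a Dedekind domain *)

Section FiniteAlgebra.
Variables (Z : idomainType) (A : comNzRingType) (e : {rmorphism Z -> A}).
Variables (gens : seq A) (gensP : forall x, zspan e gens x).

(** Determinant trick: the characteristic polynomial of multiplication by [x], evaluated at [x],
    kills every generator, hence kills 1. *)
Lemma finite_integral x : integralOver e x.
Proof.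
have /boolp.choice[c cE] : forall i : 'I_(size gens), exists c : 'I_(size gens) -> Z,
    x * gens`_i = \sum_(j < size gens) e (c j) * gens`_j.
  by move=> i; apply/zspan_sum/gensP.
pose C : 'M[Z]_(size gens) := \matrix_(i, j) c i j.
pose v : 'cV[A]_(size gens) := \col_i gens`_i.
exists (char_poly C); first exact: char_poly_monic.
rewrite map_char_poly; set D := map_mx e C.
have kerv : (x%:M - D) *m v = 0.
  apply/matrixP => i j; rewrite mulmxBl mul_scalar_mx !mxE cE.
  rewrite -sumrB big1 // => k _; by rewrite !mxE subrr.
have det0 : \det (x%:M - D) *: v = 0.
  by rewrite -mul_scalar_mx -mul_adj_mx -mulmxA kerv mulmx0.
have -> : root (char_poly D) x = (\det (x%:M - D) == 0).
  rewrite /root /char_poly -horner_evalE -det_map_mx; congr (\det _ == 0).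
  by apply/matrixP => i j; rewrite !mxE raddfB raddfMn /= /horner_eval !hornerE.
have [a ha] := (zspan_sum e gens 1).1 (gensP 1).
rewrite -[\det _]mulr1 {}ha mulr_sumr big1 // => i _.
have := congr1 (fun w : 'cV[A]__ => w i 0) det0.
by rewrite !mxE mulrCA => ->; rewrite mulr0.
Qed.

(* In a quotient of A killed by a maximal ideal of Z, the lowest nonzero term
   of an integral equation of x shows that some power of x is divisible by the
   next one. *)
Lemma quasi_inverse (a : A -> Prop) :
    a 0 -> (forall c u v, a u -> a v -> a (c * u + v)) ->
    (forall z, ~ a (e z) -> exists c, a (1 - e z * c)) ->
  forall x, exists k y, a (x ^+ k * (1 - x * y)).
Proof.
move=> a0 aL aZ x; have [a1|a1] := pselect (a 1).
  by exists 0, 0; rewrite mulr0 subr0 mulr1.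
have [f /monicP mf /rootP fx] := finite_integral x.
have : exists i, ~ a (e f`_i).
  by exists (size f).-1; rewrite -lead_coefE mf rmorph1.
have : a (x ^+ 0 * (map_poly e f).[x]) by rewrite fx mulr0.
(* Invariant: [x^j * f(x)] is in [a] and some coefficient of [f] is not. A constant term in [a] is
   dropped at the price of raising [j]; otherwise it is inverted modulo [a]. *)
move: (0%N); elim/poly_ind: f {mf fx} => [|f c IH] j.
  by move=> _ [i]; rewrite coef0 rmorph0.
rewrite rmorphD rmorphM /= map_polyX map_polyC hornerMXaddC.
set y := _.[x] in IH * => h [i fi].
have [ac|/aZ [c' hc]] := pselect (a (e c)).
  apply: (IH j.+1).
    have -> : x ^+ j.+1 * y =
        (- x ^+ j) * e c + x ^+ j * (y * x + e c) by rewrite exprS; ring.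
    exact: aL.
  move: fi; rewrite coefD coefMX coefC; case: i => [|i] /=.
    by rewrite add0r.
  by rewrite addr0 => fi; exists i.
exists j, (- c' * y).
have -> : x ^+ j * (1 - x * (- c' * y)) =
   c' * (x ^+ j * (y * x + e c)) + (x ^+ j * (1 - e c * c') + 0) by ring.
by apply: (aL) => //; apply: aL.
Qed.

Hypothesis hZ : dedekind Z.

Lemma finite_noetherian (N : A -> Prop) :
    N 0 -> (forall c x y, N x -> N y -> N (c * x + y)) ->
  exists t, forall x, N x <-> zspan e t x.
Proof.
move=> N0 NL; apply: (zspan_noetherian (dedekind_noetherian hZ)) => //.
by move=> c x y; apply: NL.
Qed.

(** If a nonzero nonunit [z] is not in [p], let [r] invert it modulo [p]. Homogenizing the integral
    equation [f(r) = 0] gives [w] congruent to [z^m * f(r) = 0] modulo [p], and [w = 0] would make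
    [z] divide the leading coefficient 1. *)
Lemma maximal_ideal_meets (p : idealr A) :
  maximal_ideal p -> exists2 z, z != 0 & e z \in p.
Proof.
move=> mp; have [z [z0 zU]] := dedekind_not_field hZ.
have [|/(maximal_ideal_inv mp)[r hr]] := boolP (e z \in p).
  by exists z.
have [f /monicP mf /rootP fr] := finite_integral r.
set m := (size f).-1; have sf : size f = m.+1.
  rewrite /m prednK // lt0n size_poly_eq0; apply/eqP => f0.
  by move/eqP: mf; rewrite f0 lead_coef0 eq_sym oner_eq0.
pose w := \sum_(i < m.+1) f`_i * z ^+ (m - i).
exists w.
  apply: contra zU => /eqP; rewrite /w big_ord_recr /= subnn mulr1.
  have -> : f`_m = 1 by rewrite -mf lead_coefE.
  under eq_bigr => i _ do rewrite -(prednK (_ : 0 < m - i)%N) ?subn_gt0 // exprS mulrCA.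
  move/eqP; rewrite -mulr_sumr addrC addr_eq0 => /eqP h.
  by move: h; set S := \sum_(i < m) _ => h; apply/unitrPr; exists (- S); rewrite mulrN -h.
have : e z ^+ m * (map_poly e f).[r] \in p by rewrite fr mulr0 idealr0.
rewrite (@horner_coef_wide _ m.+1) -?sf ?size_poly // sf mulr_sumr => h.
rewrite -(rpredBr _ h) rmorph_sum -sumrB rpred_sum // => i _.
rewrite coef_map /= rmorphM rmorphXn.
have -> : e z ^+ m = e z ^+ (m - i) * e z ^+ i by rewrite -exprD subnK // -ltnS.
have -> : e f`_i * e z ^+ (m - i) - e z ^+ (m - i) * e z ^+ i * (e f`_i * r ^+ i) =
   - (e f`_i * e z ^+ (m - i)) * ((e z * r) ^+ i - 1) by rewrite exprMn; ring.
by rewrite idealMr // subrX1 mulrC idealMr // -opprB rpredN.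
Qed.

(** The preimage of [P] in [Z] is a nonzero prime, hence maximal, so [quasi_inverse] applies;
    primality then cancels the power of [x]. *)
Lemma prime_maximal (P : idealr A) z :
    (forall u v, u * v \in P -> u \in P \/ v \in P) -> z != 0 -> e z \in P ->
  forall x, x \notin P -> exists y, 1 - x * y \in P.
Proof.
move=> prP z0 zP x xP.
pose Q : {pred Z} := fun c => e c \in P.
have Qcl : idealr_closed Q.
  split=> [||c u v uQ vQ]; rewrite /in_mem /= /Q ?rmorph0 ?idealr0 //.
    by rewrite rmorph1 idealr1.
  by rewrite rmorphD rmorphM rpredD // idealMr.
have Qpr : prime_idealr_closed Q.
  move=> u v; rewrite /in_mem /= /Q rmorphM => /prP[->//|->].
  by rewrite orbT.
pose m1 := isIdealr.Build Z Q Qcl; pose m2 := isPrimeIdealrClosed.Build Z Q Qpr.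
pose Qi : prime_idealr Z := HB.pack Q m1 m2.
have mQ : maximal_ideal Qi by apply: (dedekind_dim1 hZ); exists z.
have [||c cP|k [y hy]] := @quasi_inverse (fun x => x \in P) _ _ _ x.
- exact: idealr0.
- by move=> c u v uP vP; rewrite rpredD // idealMr.
- have [|b] := @maximal_ideal_inv _ Qi c mQ; first exact/negP.
  rewrite /in_mem /= /Q rmorphB rmorph1 rmorphM => hb; by exists (e b).
exists y; elim: k hy => [|k IH]; first by rewrite mul1r.
by rewrite exprS -mulrA => /prP[|//]; rewrite (negPf xP).
Qed.

(** Otherwise the elements [s * x^k] avoid [zA], and an ideal [P] containing [z] and maximal among
    those avoiding them is prime. It lies inside [q] and misses [x], so it contains some
    [1 - x * y], although [x] is in [q]. *)
Lemma local_power_divisible (q : idealr A) z x :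
    maximal_ideal q -> z != 0 -> x \in q ->
  exists k s y, s \notin q /\ s * x ^+ k = e z * y.
Proof.
move=> mq z0 xq.
have qM u v := @maximal_ideal_prime A q u v mq.
have q1 : 1 \notin q by rewrite idealr1.
apply: contrapT => hn.
pose M w := exists k, exists2 s, s \notin q & w = s * x ^+ k.
have [|||||P [aP PM Pmax]] := @ideal_avoiding A M (fun w => exists y, w = e z * y).
- by exists 0, 1; rewrite ?mulr1.
- move=> _ _ [k [s sq ->]] [l [t tq ->]]; exists (k + l)%N, (s * t); first exact: qM.
  by rewrite exprD; ring.
- by exists 0; rewrite mulr0.
- by move=> c _ _ [u ->] [v ->]; exists (c * u + v); ring.
- move=> _ [y ->] [k [s sq h]]; apply: hn; exists k, s, y; split=> //.
have prP u v : u * v \in P -> u \in P \/ v \in P.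
  move=> uvP; have [|/Pmax [y [m1 Mm1 h1]]] := boolP (u \in P); first by left.
  have [|/Pmax [y' [m2 Mm2 h2]]] := boolP (v \in P); first by right.
  have [] := PM (m1 * m2) _ _.
    have -> : m1 * m2 = m2 * (m1 - u * y) + (u * y) * (m2 - v * y') + (y * y') * (u * v).
      by ring.
    by rewrite !rpredD // idealMr.
  move: Mm1 Mm2 => [k [s sq ->]] [l [t tq ->]].
  exists (k + l)%N, (s * t); first exact: qM.
  by rewrite exprD; ring.
have zP : e z \in P by apply: aP; exists 1; rewrite mulr1.
have xP : x \notin P.
  by apply/negP => /PM; apply; exists 1%N, 1 => //; rewrite mul1r.
have [y hy] := prime_maximal prP z0 zP xP.
case/negP: q1; rewrite -(subrK (x * y) 1) rpredD //; last by rewrite mulrC idealMr.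
apply/negPn/negP => nq; apply: (PM _ hy); exists 0%N, (1 - x * y) => //.
by rewrite expr0 mulr1.
Qed.

(** Pigeonhole: a word longer than [size s * k] repeats some letter at least [k] times. *)
Lemma prod_nilpotent (D : A -> Prop) (s : seq A) k (w : seq A) :
    (forall c u, D u -> D (c * u)) -> (forall g, g \in s -> D (g ^+ k)) ->
    {subset w <= s} -> (size s * k < size w)%N -> D (\prod_(x <- w) x).
Proof.
move=> DM; elim: s w => [|g s IH] w Ds ws hw.
  by case: w ws hw => // x w /(_ x (mem_head _ _)).
rewrite (bigID (pred1 g)) /=.
have [le|gt] := leqP k (count_mem g w).
  rewrite (eq_bigr (fun _ => g)) => [|x /eqP //].
  rewrite big_const_seq iter_mulr_1 -(subnK le) exprD mulrC mulrA.
  by apply: DM; apply: Ds; rewrite mem_head.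
rewrite -[X in _ * X]big_filter; apply: DM; apply: IH.
- by move=> x xs; apply: Ds; rewrite inE xs orbT.
- by move=> x; rewrite mem_filter => /andP[/negPf xg /ws]; rewrite inE xg.
have := count_predC (pred1 g) w; rewrite size_filter => h.
move: hw; rewrite /= mulSn -h => hw.
have : (k + size s * k < k + count (predC (pred1 g)) w)%N.
  by apply: leq_trans hw _; rewrite leq_add2r ltnW.
by rewrite ltn_add2l.
Qed.

Lemma powset_ind (q : idealr A) (s : seq A) n (E : A -> Prop) :
    (forall x, x \in q -> zspan e s x) ->
    E 0 -> (forall c x y, E x -> E y -> E (c * x + y)) ->
    (forall w : seq A, {subset w <= s} -> size w = n.+1 -> E (\prod_(x <- w) x)) ->
  forall x, x \in ideal_pow q n -> E x.
Proof.
move=> qs; elim: n E => [|n IH] E E0 EL Ew x xq.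
  apply: (@zspan_ind _ _ e E s E0) (qs x xq) => [c|y ys]; first exact: EL.
  have -> : y = \prod_(z <- [:: y]) z by rewrite big_seq1.
  by apply: Ew => // z; rewrite inE => /eqP ->.
have {xq} /asboolP[t ht ->] : x \in prodset q (powset q n) by [].
elim: t ht => [|u t IHt] ht; first by rewrite big_nil.
rewrite big_cons -[X in _ + X]mul1r addrC.
apply: (EL); first by apply: IHt => v vt; apply: ht; rewrite inE vt orbT.
have [/qs u1 u2] := ht u (mem_head _ _).
apply: (@zspan_ind _ _ e (fun y => E (y * u.2)) s) u1.
- by rewrite mul0r.
- by move=> c a b; rewrite mulrDl -mulrA; apply: EL.
move=> g gs; apply: (IH (fun y => E (g * y))) u2.
- by rewrite mulr0.
- by move=> c a b; rewrite mulrDr mulrCA; apply: EL.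
move=> w ws sw.
have -> : g * \prod_(x <- w) x = \prod_(x <- g :: w) x by rewrite big_cons.
apply: Ew; last by rewrite /= sw.
by move=> y; rewrite inE => /orP[/eqP ->|/ws].
Qed.

(** This replaces a primary decomposition of [zA]. A common [s] and [k] serve all the finitely many
    generators of [q], and long words in them contain a [k]-th power. *)
Lemma local_ideal_pow_divisible (q : idealr A) z :
    maximal_ideal q -> z != 0 ->
  exists n s, s \notin q /\
    forall x, x \in ideal_pow q n -> exists y, s * x = e z * y.
Proof.
move=> mq z0.
have [||t tE] := @finite_noetherian (fun x => x \in q).
- exact: idealr0.
- by move=> c u v uP vP; rewrite rpredD // idealMr.
have qM u v := @maximal_ideal_prime A q u v mq.
have [k [s [sq hs]]] : exists k s, s \notin q /\
    forall g, g \in t -> exists y, s * g ^+ k = e z * y.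
  have : forall g, g \in t -> g \in q by move=> g gt; apply/tE/zspan_mem.
  elim: t {tE} => [|g t IH] tq; first by exists 0, 1; rewrite idealr1.
  have [|k [s [sq hs]]] := IH; first by move=> h ht; apply: tq; rewrite inE ht orbT.
  have [l [r [y [rq hr]]]] := local_power_divisible mq z0 (tq g (mem_head _ _)).
  exists (k + l)%N, (s * r); split; first exact: qM.
  move=> h; rewrite inE => /orP[/eqP ->|/hs [w hw]].
    exists (s * g ^+ k * y).
    have -> : e z * (s * g ^+ k * y) = s * g ^+ k * (e z * y) by ring.
    by rewrite -hr exprD; ring.
  exists (r * h ^+ l * w).
  have -> : e z * (r * h ^+ l * w) = r * h ^+ l * (e z * w) by ring.
  by rewrite -hw exprD; ring.
(* [ideal_pow q n] is spanned by words of length [n+1], just above the pigeonhole bound. *)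
exists (size t * k)%N, s; split=> // x.
apply: (@powset_ind q t _ (fun x => exists y, s * x = e z * y)).
- by move=> y /tE.
- by exists 0; rewrite !mulr0.
- move=> c u v [a ha] [b hb]; exists (c * a + b).
  by rewrite mulrDr mulrCA ha hb; ring.
- move=> w wt sw.
  apply: (@prod_nilpotent (fun x => exists y, s * x = e z * y) t k) => //.
    by move=> c u [y hy]; exists (c * y); rewrite mulrCA hy; ring.
  by rewrite sw.
Qed.

End FiniteAlgebra.

(** * Lattices *)

Section Lattice.
Variables (Z : idomainType) (K : comAlgType {fraction Z}).
Implicit Types (I J L : {pred K}) (S : subringClosed K).

Definition zemb : {rmorphism Z -> K} := in_alg K \o @FracField.tofrac Z.

Lemma zembZ c (x : K) : FracField.tofrac c *: x = zemb c * x.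
Proof. by rewrite /= mulr_algl. Qed.

Lemma zemb_inv z : z != 0 -> exists y, zemb z * y = 1.
Proof.
move=> z0; exists ((FracField.tofrac z)^-1)%:A.
by rewrite -zembZ scalerA divff ?scale1r // tofrac_eq0.
Qed.

Lemma zemb_inj z x y : z != 0 -> zemb z * x = zemb z * y -> x = y.
Proof.
move=> /zemb_inv[w hw] h; rewrite -[x]mul1r -[y]mul1r -hw.
by rewrite ![zemb z * w]mulrC -!mulrA h.
Qed.

Lemma lattice_zspan I : lattice I -> exists s, forall x, x \in I <-> zspan zemb s x.
Proof.
case=> [[s hs] _]; exists s => x; rewrite hs zspan_sum.
by split=> -[c ->]; exists c; apply: eq_bigr => i _; rewrite zembZ.
Qed.

Lemma lattice0 I : lattice I -> 0 \in I.
Proof. by case/lattice_zspan => s hs; apply/hs/zspan0. Qed.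

Lemma latticeL I c x y : lattice I -> x \in I -> y \in I -> zemb c * x + y \in I.
Proof.
by case/lattice_zspan => s hs /hs hx /hs hy; apply/hs/zspanL.
Qed.

Lemma latticeM I c x : lattice I -> x \in I -> zemb c * x \in I.
Proof.
by move=> hI xI; rewrite -[_ * _]addr0; apply: latticeL => //; apply: lattice0.
Qed.

Lemma latticeD I x y : lattice I -> x \in I -> y \in I -> x + y \in I.
Proof.
by move=> hI xI yI; rewrite -[x]mul1r -(rmorph1 zemb); apply: latticeL.
Qed.

Lemma fraction_denominator (a : {fraction Z}) :
  exists2 d, d != 0 & exists n, FracField.tofrac d * a = FracField.tofrac n.
Proof.
elim/quotW: a => -[[n d] /= d0]; exists d => //; exists n.
unlock FracField.tofrac; rewrite -[LHS]FracField.pi_mul.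
apply/eqP; rewrite -[_ == _]/(_ == _ %[mod _]) FracField.equivf_def /=.
by rewrite !numer_Ratio ?denom_Ratio ?oner_neq0 ?mul1r ?mulr1 //= mulrC.
Qed.

Lemma lattice_denominator I x :
  lattice I -> exists2 d, d != 0 & zemb d * x \in I.
Proof.
move=> hI; have [_ [n [b [bI hb]]]] := hI.
have [c [-> _]] := hb x.
elim/big_ind: _ => [|u v [d d0 hu] [f f0 hv]|i _].
- by exists 1; rewrite ?oner_eq0 // mulr0 lattice0.
- exists (d * f); first by rewrite mulf_neq0.
  rewrite mulrDr latticeD //; last by rewrite rmorphM -mulrA latticeM.
  by rewrite rmorphM [zemb d * _]mulrC -mulrA latticeM.
have [d d0 [m hm]] := fraction_denominator (c i).
by exists d => //; rewrite -zembZ scalerA hm zembZ latticeM.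
Qed.

Lemma lattice_commensurable I J : lattice I -> lattice J ->
  exists2 d, d != 0 & forall x, x \in J -> zemb d * x \in I.
Proof.
move=> hI /lattice_zspan[s hs].
have [d d0 hd] : exists2 d, d != 0 & forall x, x \in s -> zemb d * x \in I.
  elim: s {hs} => [|g s [d d0 hd]]; first by exists 1; rewrite ?oner_eq0.
  have [f f0 hf] := lattice_denominator g hI.
  exists (d * f) => [|x]; first by rewrite mulf_neq0.
  rewrite inE rmorphM => /orP[/eqP ->|/hd h]; first by rewrite -mulrA latticeM.
  by rewrite [zemb d * _]mulrC -mulrA latticeM.
exists d => // x /hs; apply: (@zspan_ind _ _ zemb (fun x => zemb d * x \in I)).
- by rewrite mulr0 lattice0.
- by move=> c u v hu hv; rewrite mulrDr mulrCA latticeL.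
- exact: hd.
Qed.

Lemma zspan_scale w s x : zspan zemb s x -> zspan zemb (map ( *%R w) s) (w * x).
Proof.
elim: s x => [x ->|g s IH x [c /IH h]] /=; first by rewrite mulr0.
by exists c; move: h; rewrite mulrBr mulrCA.
Qed.

(** Generators come from [f I] being a submodule of the finitely generated [L], and a basis from
    multiplying one inside [J] by [d]. *)
Lemma lattice_between I J L d f :
    noetherian Z -> lattice J -> lattice L -> d != 0 -> f != 0 ->
    0 \in I -> (forall c x y, x \in I -> y \in I -> zemb c * x + y \in I) ->
    (forall x, x \in J -> zemb d * x \in I) ->
    (forall x, x \in I -> zemb f * x \in L) ->
  lattice I.
Proof.
move=> nZ [_ [n [b [bJ hb]]]] /lattice_zspan[s hs] d0 f0 I0 IL hd hf; split.
  have [w fw] := zemb_inv f0.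
  pose N y := exists2 x, x \in I & y = zemb f * x.
  have [|c _ _ [x xI ->] [y yI ->]|_ [x xI ->]|t ht] :=
    @zspan_noetherian _ nZ _ zemb s N.
  - by exists 0; rewrite ?mulr0.
  - by exists (zemb c * x + y); [apply: IL | rewrite mulrDr mulrCA].
  - exact/hs/hf.
  exists (map ( *%R w) t) => x.
  have -> : x \in I <-> zspan zemb (map ( *%R w) t) x.
    split=> [xI|h].
      rewrite -[x]mul1r -fw [zemb f * w]mulrC -mulrA.
      by apply: zspan_scale; apply/ht; exists x.
    have /ht[y yI /(zemb_inj f0) -> //] : zspan zemb t (zemb f * x).
    have := zspan_scale (zemb f) h; rewrite -map_comp (eq_map (g := id)) ?map_id //.
    by move=> y; rewrite /= mulrA fw mul1r.
  rewrite zspan_sum.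
  by split=> -[c ->]; exists c; apply: eq_bigr => i _; rewrite zembZ.
exists n, (fun i => zemb d * b i); split=> [i|x]; first exact/hd/bJ.
set t := FracField.tofrac d; have t0 : t != 0 by rewrite tofrac_eq0.
have bE i (a : {fraction Z}) : a *: (zemb d * b i) = (a * t) *: b i.
  by rewrite -zembZ scalerA.
have [c [xc cuniq]] := hb x.
exists [ffun i => c i / t]; split.
  by rewrite xc; apply: eq_bigr => i _; rewrite ffunE bE divfK.
move=> c' hc'; apply/ffunP => i; rewrite ffunE.
have /cuniq -> : x = \sum_(i < n) [ffun i => c' i * t] i *: b i.
  by rewrite hc'; apply: eq_bigr => j _; rewrite ffunE bE.
by rewrite ffunE mulfK.
Qed.

Lemma order_zemb S z : lattice S -> zemb z \in S.
Proof.
by move=> hS; rewrite -[zemb z]mulr1; apply: (latticeM z hS); apply: rpred1.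
Qed.

Lemma order_finite S : lattice S ->
  exists e : {rmorphism Z -> subring_of S}, (forall z, val (e z) = zemb z) /\
    exists gens, forall x, zspan e gens x.
Proof.
move=> hS; pose h z : subring_of S := SubringOf (order_zemb z hS).
have hB : zmod_morphism h by move=> x y; apply/val_inj/(rmorphB zemb).
have hM : monoid_morphism h.
  by split=> [|x y]; apply: val_inj; [apply: (rmorph1 zemb)|apply: (rmorphM zemb)].
pose m1 := GRing.isZmodMorphism.Build Z (subring_of S) h hB.
pose m2 := GRing.isMonoidMorphism.Build Z (subring_of S) h hM.
pose e : {rmorphism Z -> subring_of S} := HB.pack h m1 m2.
exists e; split=> //; have [s hs] := lattice_zspan hS.
have [t ts] : exists t : seq (subring_of S), map val t = s.
  have {hs}: forall x, x \in s -> x \in S by move=> x xs; apply/hs/zspan_mem.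
  elim: s => [|g s IH] sS; first by exists [::].
  have [|t <-] := IH; first by move=> x xs; apply: sS; rewrite inE xs orbT.
  by exists (SubringOf (sS g (mem_head _ _)) :: t).
exists t => x; have /hs : val x \in S by apply: valP.
rewrite -{}ts; elim: t x => [|g t IH] x /=; first by move=> h0; apply: val_inj.
move=> [c hc]; by exists c; apply: IH.
Qed.

End Lattice.

(** * Weak equivalence through colon ideals *)

Section ProdSet.
Variables (A : comNzRingType) (P N : {pred A}).

Lemma mem_prodset x y : x \in P -> y \in N -> x * y \in prodset P N.
Proof.
move=> xP yN; apply/asboolP; exists [:: (x, y)]; last by rewrite big_seq1.
by move=> u; rewrite inE => /eqP ->.
Qed.

Lemma prodset0 : 0 \in prodset P N.
Proof. by apply/asboolP; exists [::]; rewrite ?big_nil. Qed.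

Lemma prodsetD x y :
  x \in prodset P N -> y \in prodset P N -> x + y \in prodset P N.
Proof.
move=> /asboolP[s hs ->] /asboolP[t ht ->]; apply/asboolP.
exists (s ++ t); last by rewrite big_cat.
by move=> u; rewrite mem_cat => /orP[/hs|/ht].
Qed.

Lemma prodset_ind (Q : A -> Prop) :
    Q 0 -> (forall x y, Q x -> Q y -> Q (x + y)) ->
    (forall x y, x \in P -> y \in N -> Q (x * y)) ->
  forall x, x \in prodset P N -> Q x.
Proof.
move=> Q0 QD QM _ /asboolP[s hs ->]; elim: s hs => [|u s IH] hs.
  by rewrite big_nil.
have [u1 u2] := hs u (mem_head _ _).
rewrite big_cons; apply: QD; first exact: QM.
by apply: IH => v vs; apply: hs; rewrite inE vs orbT.
Qed.

Lemma prodsetMl c : (forall x, x \in P -> c * x \in P) ->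
  forall x, x \in prodset P N -> c * x \in prodset P N.
Proof.
move=> hc; apply: (prodset_ind (Q := fun x => c * x \in prodset P N)).
- by rewrite mulr0 prodset0.
- by move=> x y; rewrite mulrDr; apply: prodsetD.
- by move=> x y xP yN; rewrite mulrA mem_prodset ?hc.
Qed.

Lemma prodsetMr c : (forall x, x \in N -> c * x \in N) ->
  forall x, x \in prodset P N -> c * x \in prodset P N.
Proof.
move=> hc; apply: (prodset_ind (Q := fun x => c * x \in prodset P N)).
- by rewrite mulr0 prodset0.
- by move=> x y; rewrite mulrDr; apply: prodsetD.
- by move=> x y xP yN; rewrite mulrCA mem_prodset ?hc.
Qed.

End ProdSet.

Lemma linear_inverse (A : comNzRingType) (V W : lmodType A)
    (g : {linear V -> W}) : bijective g ->
  exists h : {linear W -> V}, cancel g h /\ cancel h g.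
Proof.
case=> h' gK hK; have lh : linear h'.
  by move=> a x y; apply: (can_inj gK); rewrite linearP !hK.
pose mx := GRing.isLinear.Build A W V *:%R h' lh.
by pose h : {linear W -> V} := HB.pack h' mx; exists h.
Qed.

Section WeakEquivalence.
Variables (Z : idomainType) (K : comAlgType {fraction Z}) (S : subringClosed K).
Implicit Types I J L : fracideal S.

Local Notation extq q I := (ext_scalars (completion_map q) (fi_elt I)).

Lemma weak_equiv_sym I J : weak_equiv I J -> weak_equiv J I.
Proof.
move=> h q mq; have [g /linear_inverse[k [gK kK]]] := h q mq.
by exists k; exists g.
Qed.

Lemma weak_equiv_trans J I L :
  weak_equiv I J -> weak_equiv J L -> weak_equiv I L.
Proof.
move=> h1 h2 q mq; have [g gb] := h1 q mq; have [h hb] := h2 q mq.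
by exists (h \o g : {linear _ -> _}); apply: bij_comp.
Qed.

Lemma lspan_divisible I (q : idealr (subring_of S)) n (s D : subring_of S)
    (y : fi_elt I) :
    (forall a, a \in ideal_pow q n -> exists b, s * a = D * b) ->
    y \in lspan (ideal_smul (ideal_pow q n) (M:=fi_elt I)) ->
  exists2 w, w \in I & val s * val y = val D * w.
Proof.
move=> hs /asboolP[t ht ->]; elim: t ht => [|u t IH] ht.
  by rewrite big_nil; exists 0; rewrite ?mulr0 ?rpred0.
rewrite big_cons; have [|w wI e] := IH.
  by move=> v vt; apply: ht; rewrite inE vt orbT.
have [a [x /hs [b hb] ->]] := ht u (mem_head _ _).
exists (val u.1 * (val b * val x) + w).
  by rewrite rpredD // !fi_stable //; apply: valP.
rewrite raddfD !mulrDr e; congr (_ + _) => /=.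
have := congr1 val hb => /= {}hb.
by rewrite [LHS]mulrCA (mulrA (srval s)) hb; ring.
Qed.

(** Computing [phi (d^2 x) = phi ((d x) d)] in two ways gives [d^2 phi(x)] and [d x phi(d)], up to
    the error. Dividing by [d^2] shows that [phi] is nearly multiplication by [phi(d) / d]. *)
Lemma approx_multiplier I J (q : idealr (subring_of S)) n (s : subring_of S)
    (d d' D : K) (dS : d \in S) (dI : d \in I) (phi : fi_elt I -> fi_elt J) :
    d * d' = 1 -> (forall x, x \in I -> d * x \in S) ->
    (forall y, y \in lspan (ideal_smul (ideal_pow q n) (M:=fi_elt J)) ->
       exists2 w, w \in J & val s * val y = d ^+ 2 * D * w) ->
    (forall a x, phi (a *: x) - a *: phi x \in
       lspan (ideal_smul (ideal_pow q n) (M:=fi_elt J))) ->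
  forall x : fi_elt I, exists2 w, w \in J &
    val s * (val (phi (FiElt dI)) * d' * val x) = val s * val (phi x) + D * w.
Proof.
move=> dd' dIS hs phiZ x.
pose c : subring_of S := SubringOf (dIS _ (valP x)).
have d2S : d ^+ 2 \in S by rewrite rpredX.
pose d2 : subring_of S := SubringOf d2S.
have cd : c *: (FiElt dI) = d2 *: x.
  by apply: val_inj => /=; rewrite expr2; ring.
have [w wJ hw] := hs _ (phiZ c (FiElt dI)).
have [v vJ hv] := hs _ (phiZ d2 x).
exists (v - w); first by rewrite rpredB.
move: hw hv; rewrite cd /= => hw hv.
set sx := val s in hw hv *; set a := fi_val (phi (FiElt dI)) in hw *.
set y := fi_val (phi x) in hv *; set z := fi_val (phi (d2 *: x)) in hw hv.
have h : sx * (d * fi_val x * a - d ^+ 2 * y) = d ^+ 2 * D * (v - w).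
  by rewrite mulrBr [RHS]mulrBr -hw -hv; ring.
have -> : D * (v - w) = d' ^+ 2 * (d ^+ 2 * D * (v - w)).
  by rewrite -[LHS]mul1r -(expr1n _ 2) -dd'; ring.
have e1 : d' ^+ 2 * (d * fi_val x * a) = a * d' * fi_val x.
  by rewrite expr2 -[RHS]mul1r -dd'; ring.
have e2 : d' ^+ 2 * (d ^+ 2 * y) = y.
  by rewrite -[RHS]mul1r -(expr1n _ 2) -dd'; ring.
by rewrite -h [_ ^+ 2 * (sx * _)]mulrCA (mulrBr (d' ^+ 2)) e1 e2; ring.
Qed.

Lemma colon_weak_equiv I J : dedekind Z -> is_order S ->
  weak_equiv I J -> 1 \in prodset (colon I J) (colon J I).
Proof.
move=> hZ hS hw; set X := prodset _ _.
have XS c x : c \in S -> x \in X -> c * x \in X.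
  move=> cS; apply: prodsetMl => y /asboolP hy; apply/asboolP => z zJ.
  by rewrite -mulrA fi_stable ?hy.
apply/negPn/negP => X1.
have [|||q mq aq] := @maximal_ideal_containing (subring_of S) (fun c => val c \in X).
- exact: prodset0.
- move=> c u v uX vX; rewrite (_ : val (c * u + v) = val c * val u + val v) //.
  by rewrite prodsetD // XS //; exact: valP.
- exact/negP.
have [e [eE [gens gensP]]] := order_finite hS.
have [D D0 [DI DJ IS JS]] : exists2 D, D != 0 & [/\ zemb K D \in I, zemb K D \in J,
    forall x, x \in I -> zemb K D * x \in S & forall x, x \in J -> zemb K D * x \in S].
  have [d1 n1 h1] := lattice_commensurable (fi_lattice I) hS.
  have [d2 n2 h2] := lattice_commensurable (fi_lattice J) hS.
  have [d3 n3 h3] := lattice_commensurable hS (fi_lattice I).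
  have [d4 n4 h4] := lattice_commensurable hS (fi_lattice J).
  have S1 : 1 \in S by apply: rpred1.
  exists (d1 * d2 * d3 * d4); first by rewrite !mulf_neq0.
  have mS d := order_zemb d hS.
  split=> [||x /h3 h|x /h4 h]; rewrite !rmorphM.
  - have -> : zemb K d1 * zemb K d2 * zemb K d3 * zemb K d4 =
      zemb K d2 * zemb K d3 * zemb K d4 * (zemb K d1 * 1) by ring.
    by rewrite fi_stable ?h1 // !rpredM ?mS.
  - have -> : zemb K d1 * zemb K d2 * zemb K d3 * zemb K d4 =
      zemb K d1 * zemb K d3 * zemb K d4 * (zemb K d2 * 1) by ring.
    by rewrite fi_stable ?h2 // !rpredM ?mS.
  - have -> : zemb K d1 * zemb K d2 * zemb K d3 * zemb K d4 * x =
      zemb K d1 * zemb K d2 * zemb K d4 * (zemb K d3 * x) by ring.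
    by rewrite rpredM // !rpredM ?mS.
  - have -> : zemb K d1 * zemb K d2 * zemb K d3 * zemb K d4 * x =
      zemb K d1 * zemb K d2 * zemb K d3 * (zemb K d4 * x) by ring.
    by rewrite rpredM // !rpredM ?mS.
(* Eight factors [d]: two are spent in [approx_multiplier], one on the denominator left in the
   product of the two multipliers, one moves an element of [J] into [S], and four move [S] into
   [X]. *)
have [n [s [sq hs]]] := local_ideal_pow_divisible gensP hZ mq
  (expf_neq0 8 D0 : D ^+ 8 != 0).
have [g /linear_inverse[h [_ hK]]] := hw q mq.
have [phi [psi [phiZ psiZ phiK]]] := @ext_iso_approx _ q n _ _ g h hK.
have [d' dd'] := zemb_inv K D0.
set d := zemb K D in DI DJ IS JS dd' *.
have dS : d \in S by apply: order_zemb.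
have hs' L y : y \in lspan (ideal_smul (ideal_pow q n) (M:=fi_elt L)) ->
    exists2 w, w \in L & val s * val y = d ^+ 2 * d ^+ 6 * w.
  move=> /(lspan_divisible hs)[w wL ->]; exists w => //.
  by rewrite eE rmorphXn -exprD.
have aphi := approx_multiplier dS DI dd' IS (hs' J) phiZ.
have apsi := approx_multiplier dS DJ dd' JS (hs' I) psiZ.
set a := val (phi _) in aphi; set b := val (psi _) in apsi.
have sS : val s \in S by apply: valP.
have stab L w : w \in L -> d ^+ 6 * w \in L by move=> wL; rewrite fi_stable ?rpredX.
have alpha : val s * (a * d') \in colon J I.
  apply/asboolP => x xI; have [w wJ /= ew] := aphi (FiElt xI).
  rewrite -[_ * x]mulrA /= ew rpredD ?stab // fi_stable //; exact: valP.
have beta : val s * (b * d') \in colon I J.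
  apply/asboolP => x xJ; have [w wI /= ew] := apsi (FiElt xJ).
  rewrite -[_ * x]mulrA /= ew rpredD ?stab // fi_stable //; exact: valP.
(* At [psi d] the multiplier of [phi] yields nearly [s * phi (psi d)], which is nearly [s * d]; so
   the product of the two multipliers is nearly [s^2]. *)
have [w wJ hww] := aphi (psi (FiElt DJ)).
have [v vJ] := hs' J _ (phiK (FiElt DJ)).
rewrite raddfB /= mulrBr => /eqP; rewrite subr_eq -exprD => /eqP hv.
rewrite -/b /= hv in hww.
(* [d^2] lies in both colons: one factor carries the source into [S], the other lies in the
   target. *)
have d4 c : c \in S -> d ^+ 4 * c \in X.
  move=> cS; rewrite mulrC XS // (_ : d ^+ 4 = d ^+ 2 * d ^+ 2); last by rewrite -exprD.
  apply: mem_prodset; apply/asboolP => x /[dup].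
    by move=> _ /JS xS; rewrite expr2 -mulrA mulrC fi_stable.
  by move=> _ /IS xS; rewrite expr2 -mulrA mulrC fi_stable.
have /negP := maximal_ideal_prime mq sq sq; apply; apply: aq.
have -> : val (s * s) = (val s * (b * d')) * (val s * (a * d')) +
   d ^+ 4 * (- val s * (d * (d ^+ 2 * v + w))).
  have -> : (val s * (b * d')) * (val s * (a * d')) =
      val s * (d' * (val s * (a * d' * b))) by ring.
  rewrite hww.
  have -> : d' * (d ^+ 8 * v + val s * d + d ^+ 6 * w) =
      (d * d') * (d ^+ 7 * v + val s + d ^+ 5 * w) by ring.
  by rewrite dd' /=; ring.
rewrite prodsetD //; first by apply: mem_prodset.
apply: d4; rewrite rpredM ?rpredN //; apply: JS.
by rewrite rpredD // fi_stable ?rpredX.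
Qed.

End WeakEquivalence.

(** * Generators over semilocal rings *)

Section SemilocalGenerator.
Variables (K : comNzRingType) (T : subringClosed K).

(** Each term of the binomial expansion with exponent [n + m] contains [u^n] or [v^m]. *)
Lemma radical_ideal (p : K -> Prop) :
    p 0 -> (forall c u v, c \in T -> p u -> p v -> p (c * u + v)) ->
  forall c u v, c \in T -> u \in T -> v \in T ->
    (exists n, p (u ^+ n)) -> (exists n, p (v ^+ n)) ->
  exists n, p ((c * u + v) ^+ n).
Proof.
move=> p0 pL c u v cT uT vT [n un] [m vm]; exists (n + m)%N.
have pM d w : d \in T -> p w -> p (d * w).
  by move=> dT pw; rewrite -[d * w]addr0; apply: pL.
have pD w z : p w -> p z -> p (w + z).
  by move=> pw pz; rewrite -[w]mul1r; apply: pL => //; apply: rpred1.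
rewrite exprDn; elim/big_ind: _ => [//|//|i _].
rewrite -mulr_natl; apply: (pM); first exact: rpred_nat.
have [le|lt] := leqP m i.
  rewrite -[in v ^+ _](subnK le) exprD mulrA.
  by apply: pM; rewrite // rpredM ?rpredX ?rpredM.
have le : (n <= n + m - i)%N by rewrite -addnBA ?leq_addr // ltnW.
have -> : (c * u) ^+ (n + m - i) * v ^+ i =
    (c * u) ^+ (n + m - i - n) * c ^+ n * v ^+ i * u ^+ n.
  by rewrite -[in LHS](subnK le) exprD [(c * u) ^+ n]exprMn; ring.
by apply: pM; rewrite // !(rpredM, rpredX).
Qed.

Local Ltac solve_mem := repeat first
  [ assumption | exact: rpred1 | apply: rpredB | apply: rpredD
  | rewrite rpredN | apply: rpredM ].

(* [T / P] is von Neumann regular, so a sum of elements of [L * L'] can be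
   replaced modulo [P] by one product: cut out by idempotents the part of [T]
   on which the partial sum is already a unit. *)
Lemma regular_generator (P : K -> Prop) (L L' : {pred K}) :
    P 0 -> (forall c u v, c \in T -> P u -> P v -> P (c * u + v)) ->
    (forall t, t \in T -> exists2 y, y \in T & P (t * (1 - t * y))) ->
    0 \in L -> (forall c x y, c \in T -> x \in L -> y \in L -> c * x + y \in L) ->
    0 \in L' -> (forall c x y, c \in T -> x \in L' -> y \in L' -> c * x + y \in L') ->
    (forall x y, x \in L -> y \in L' -> x * y \in T) ->
  forall t, t \in prodset L L' ->
  exists x x', [/\ x \in L, x' \in L', P (x * x' * (1 - x * x')) &
    P ((1 - x * x') * t)].
Proof.
move=> P0 PL reg L0 LL L'0 L'L LLT _ /asboolP[s hs ->].
have PM d w : d \in T -> P w -> P (d * w).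
  by move=> dT pw; rewrite -[d * w]addr0; apply: PL.
have PD w z : P w -> P z -> P (w + z).
  by move=> pw pz; rewrite -[w]mul1r; apply: PL => //; apply: rpred1.
elim: s hs => [|[a b] s IH] hs.
  by exists 0, 0; rewrite big_nil !mulr0 mul0r.
have [|x [x' [xL x'L g1 g2]]] := IH.
  by move=> v vs; apply: hs; rewrite inE vs orbT.
have /= [aL bL] := hs _ (mem_head _ _).
rewrite big_cons /=; set E := x * x' in g1 g2; set t0 := \sum_(j <- s) _ in g2 *.
have ET : E \in T by apply: LLT.
have abT : a * b \in T by apply: LLT.
have xbT : x * b \in T by apply: LLT.
have axT : a * x' \in T by apply: LLT.
have E1T : 1 - E \in T by rewrite rpredB ?rpred1.
have t0T : t0 \in T.
  rewrite /t0 big_seq rpred_sum // => u us.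
  have [|u1 u2] := hs u; first by rewrite inE us orbT.
  exact: LLT.
pose t := (1 - E) * (a * b); have tT : t \in T by rewrite rpredM.
have [y yT g3] := reg t tT.
(* Modulo [P], [t * y] is idempotent and killed by [E], so the new product [E + t * y] is a sum of
   orthogonal idempotents. *)
exists (E * x + ((1 - E) * a + 0)), (E * x' + ((1 - E) * y * b + 0)).
have T1 : 1 \in T by apply: rpred1.
(* [C] collects the cross terms, all multiples of [E * (1 - E)], which lies in [P]. *)
pose C := - (1 + E) + y * (x * b) + a * x' - a * b * y.
have CT : C \in T by rewrite /C; solve_mem.
have xxE : (E * x + ((1 - E) * a + 0)) * (E * x' + ((1 - E) * y * b + 0)) =
    E + t * y + E * (1 - E) * C by rewrite /C /t /E; ring.
split.
- by apply: (LL) => //; apply: LL.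
- by apply: (L'L) => //; apply: L'L => //; rewrite rpredM.
- rewrite xxE.
  have -> : (E + t * y + E * (1 - E) * C) * (1 - (E + t * y + E * (1 - E) * C)) =
     (1 - a * b * y - a * b * y +
       C * (1 - (E + t * y + E * (1 - E) * C) - (E + t * y))) * (E * (1 - E)) +
     y * (t * (1 - t * y)).
    rewrite /t; ring.
  apply: PL => //; last exact: PM.
  by solve_mem.
- rewrite xxE.
  have -> : (1 - (E + t * y + E * (1 - E) * C)) * (a * b + t0) =
      (1 - a * b * y) * ((1 - E) * t0) +
      ((- (C * t0) - C * (a * b) - a * b * y * (a * b)) * (E * (1 - E)) +
        t * (1 - t * y)).
    rewrite /t; ring.
  apply: (PL) => //; first by solve_mem.
  apply: PL => //.
  by solve_mem.
Qed.

(** [regular_generator] is applied modulo the radical [P] of [p], where the given power condition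
    becomes von Neumann regularity. Multiplying the conclusion by [L] gives [L = x T + p L]. *)
Lemma semilocal_generator (p : K -> Prop) (L L' : {pred K}) :
    p 0 -> (forall c u v, c \in T -> p u -> p v -> p (c * u + v)) ->
    (forall t, t \in T -> exists k, exists2 y, y \in T & p (t ^+ k * (1 - t * y))) ->
    0 \in L -> (forall c x y, c \in T -> x \in L -> y \in L -> c * x + y \in L) ->
    0 \in L' -> (forall c x y, c \in T -> x \in L' -> y \in L' -> c * x + y \in L') ->
    (forall x y, x \in L -> y \in L' -> x * y \in T) ->
    1 \in prodset L L' ->
  exists x x', [/\ x \in L, x' \in L' & p (x * x' - 1)].
Proof.
move=> p0 pL reg L0 LL L'0 L'L LLT h1.
have T1 : 1 \in T by apply: rpred1.
pose P u := u \in T /\ exists n, p (u ^+ n).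
have PL c u v : c \in T -> P u -> P v -> P (c * u + v).
  move=> cT [uT un] [vT vn]; split; first by rewrite rpredD ?rpredM.
  exact: radical_ideal.
have [| |x [x' [xL x'L _ [ET [n hn]]]]] := regular_generator _ PL _ L0 LL L'0 L'L LLT h1.
- by split; [apply: rpred0 | exists 1%N].
- move=> t tT; have [k [y yT hy]] := reg t tT; exists y => //; split.
    by rewrite rpredM // rpredB // rpredM.
  exists k.+1; rewrite exprMn exprS [_ ^+ k.+1]exprS.
  have -> : t * t ^+ k * ((1 - t * y) * (1 - t * y) ^+ k) =
     t * (1 - t * y) ^+ k * (t ^+ k * (1 - t * y)) + 0 by ring.
  by apply: pL => //; rewrite rpredM ?rpredX // rpredB // rpredM.
rewrite mulr1 in ET hn.
(* [1 - x * x'] is nilpotent modulo [p], so a finite geometric series corrects [x'] into an inverse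
   of [x]. *)
exists x, ((\sum_(i < n) (1 - x * x') ^+ i) * x' + 0); split=> //.
  by apply: L'L => //; rewrite rpred_sum // => i _; rewrite rpredX.
have -> : x * ((\sum_(i < n) (1 - x * x') ^+ i) * x' + 0) - 1 =
    -1 * (1 - x * x') ^+ n + 0.
  have := subrX1 (1 - x * x') n.
  set S := \sum_(i < n) _; set F := _ ^+ n => e.
  have -> : F = (F - 1) + 1 by ring.
  by rewrite e; ring.
by apply: pL => //; rewrite rpredN.
Qed.

End SemilocalGenerator.

(** * The multiplicator ring of a maximal ideal *)

Section Inclusion.
Variables (Z : idomainType) (K : comAlgType {fraction Z}) (S : subringClosed K).
Variables (p : idealr (subring_of S)).

Lemma lspan_ideal_smul (I : fracideal S) (y : fi_elt I) :
  y \in lspan (ideal_smul p (M:=fi_elt I)) <-> val y \in prodset (ideal_in p) I.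
Proof.
split=> [/asboolP[s hs ->]|].
  elim: s hs => [|u s IH] hs; first by rewrite big_nil prodset0.
  rewrite big_cons prodsetD //; last first.
    by apply: IH => v vs; apply: hs; rewrite inE vs orbT.
  have [a [x ap ->]] := hs _ (mem_head _ _); rewrite /= mulrA mem_prodset //.
    by apply/asboolP; exists (u.1 * a); rewrite ?idealMr.
  exact: valP.
move=> h; have : exists2 m : fi_elt I, val m = val y &
    m \in lspan (ideal_smul p (M:=fi_elt I)).
  move: h; apply: (prodset_ind (Q := fun y => exists2 m : fi_elt I, val m = y &
    m \in lspan (ideal_smul p (M:=fi_elt I)))).
  - by exists 0; rewrite ?rpred0.
  - by move=> _ _ [m <- hm] [l <- hl]; exists (m + l); rewrite ?rpredD.
  move=> x w /asboolP[a ap ->] wI; exists (a *: (FiElt wI : fi_elt I)) => //.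
  apply/asboolP; exists [:: (1, a *: (FiElt wI : fi_elt I))].
    by move=> u; rewrite inE => /eqP ->; exists a, (FiElt wI).
  by rewrite big_seq1 scale1r.
by move=> [m /val_inj <-].
Qed.

(** Since [pI = pJ], two elements of [I] are congruent modulo [pI] exactly when they are modulo
    [pJ]: one direction makes the map well defined, the other injective. *)
Lemma mod_ideal_inclusion (I J : fracideal S) :
    {subset I <= J} -> prodset (ideal_in p) I =i prodset (ideal_in p) J ->
  exists f : {linear mod_ideal p (fi_elt I) -> mod_ideal p (fi_elt J)},
    (forall (x : fi_elt I) (y : fi_elt J),
       fi_val x = fi_val y -> f (mod_cls p x) = mod_cls p y) /\ injective f.
Proof.
move=> IJ pIJ; pose i (x : fi_elt I) : fi_elt J := FiElt (IJ _ (valP x)).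
have surj (L : fracideal S) (x : mod_ideal p (fi_elt L)) :
    exists m, x = mod_cls p m.
  exists (repr (x : {ideal_quot lspan (ideal_smul p (M:=fi_elt L))})).
  by rewrite /mod_cls quot_cls_repr.
have iE x y : mod_cls p x = mod_cls p y <-> mod_cls p (i x) = mod_cls p (i y).
  by rewrite !mod_clsP !lspan_ideal_smul pIJ.
pose F (x : mod_ideal p (fi_elt I)) : mod_ideal p (fi_elt J) :=
  mod_cls p (i (projT1 (cid (surj I x)))).
have FE m : F (mod_cls p m) = mod_cls p (i m).
  by apply/iE; rewrite -(projT2 (cid (surj I (mod_cls p m)))).
have lF : linear F.
  move=> a x y; have [m ->] := surj I x; have [l ->] := surj I y.
  rewrite -[a]reprK -mod_clsZ.
  have <- : mod_cls p (repr a *: m + l) = mod_cls p (repr a *: m) + mod_cls p l.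
    exact: quot_clsD.
  rewrite !FE -mod_clsZ; apply: etrans _ (quot_clsD _ _ _).
  by congr quot_cls; apply: val_inj.
pose mx := GRing.isLinear.Build _ _ _ *:%R F lF.
pose f : {linear mod_ideal p (fi_elt I) -> mod_ideal p (fi_elt J)} := HB.pack F mx.
exists f; split=> [x y xy|x y].
  by rewrite /= FE; congr (mod_cls p _); apply: val_inj.
have [m ->] := surj I x; have [l ->] := surj I y.
by rewrite /= !FE => /iE.
Qed.

End Inclusion.

(** * The ring [T = (p : p)] and the extension of ideals from [R] to [T] *)

Section MultiplicatorRing.
Variables (Z : idomainType) (hZ : dedekind Z) (K : comAlgType {fraction Z}).
Variables (R : subringClosed K) (hR : is_order R).
Variables (p : idealr (subring_of R)) (hp : maximal_ideal p).
Local Notation T := (multring p).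
Local Notation pK := (ideal_in p).

Lemma ideal_in_sub x : x \in pK -> x \in R.
Proof. by move=> /asboolP[a _ ->]; apply: valP. Qed.

Lemma mem_ideal_in (a : subring_of R) : (val a \in pK) = (a \in p).
Proof.
by apply/asboolP/idP => [[b bp /val_inj -> //]|ap]; exists a.
Qed.

Lemma multringM t x : t \in T -> x \in pK -> t * x \in pK.
Proof. by move=> /asboolP h /h. Qed.

Lemma ideal_inL c u v : c \in T -> u \in pK -> v \in pK -> c * u + v \in pK.
Proof. by move=> cT up vp; rewrite rpredD ?multringM. Qed.

Lemma ideal_in_meets : exists2 D, D != 0 & zemb K D \in pK.
Proof.
have [e [eE [gens gensP]]] := order_finite hR.
have [z z0 zp] := maximal_ideal_meets gensP hZ hp.
by exists z => //; rewrite -eE mem_ideal_in.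
Qed.

Lemma multring_order : is_order T.
Proof.
have [D D0 Dp] := ideal_in_meets.
apply: (lattice_between (dedekind_noetherian hZ) hR hR (oner_neq0 _) D0).
- exact: rpred0.
- move=> c x y xT yT; rewrite rpredD // rpredM //.
  by apply: sub_multring; apply: order_zemb.
- by move=> x xR; rewrite rmorph1 mul1r; apply: sub_multring.
- by move=> x xT; apply: ideal_in_sub; rewrite mulrC multringM.
Qed.

(** Here finiteness of [T / p] over the field [R / p] enters: [T] is finite over [Z], and elements
    of [Z] outside [p] are invertible modulo [p]. *)
Lemma multring_power_regular t : t \in T ->
  exists k, exists2 y, y \in T & t ^+ k * (1 - t * y) \in pK.
Proof.
move=> tT; have [e [eE [gens gensP]]] := order_finite multring_order.
have [||z zp|k [y hy]] := quasi_inverse gensP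
  (a := fun c => val c \in pK) _ _ _ (SubringOf tT : subring_of T).
- exact: rpred0.
- move=> c u v up vp; rewrite (_ : val (c * u + v) = val c * val u + val v) //.
  by rewrite ideal_inL //; apply: valP.
- have zR : zemb K z \in R by apply: order_zemb.
  have zp' : (SubringOf zR : subring_of R) \notin p.
    by rewrite -mem_ideal_in; apply/negP; rewrite (_ : val _ = val (e z)) // eE.
  have [r hr] := maximal_ideal_inv hp zp'.
  exists (SubringOf (sub_multring p _ (valP r))).
  rewrite -[val _]/(1 - val (e z) * val r) eE.
  by move: hr; rewrite -mem_ideal_in.
exists k, (val y); first exact: valP.
move: hy; rewrite (_ : val _ = t ^+ k * (1 - t * val y)) //.
rewrite -[RHS]/(t ^+ k * val (1 - (SubringOf tT : subring_of T) * y)).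
by rewrite rmorphM rmorphXn.
Qed.

Section Extension.
Variable I : fracideal R.

Lemma sub_extension x : x \in I -> x \in prodset I T.
Proof. by move=> xI; rewrite -[x]mulr1 mem_prodset ?rpred1. Qed.

Lemma extension_stable t x : t \in T -> x \in prodset I T -> t * x \in prodset I T.
Proof. by move=> tT; apply: prodsetMr => y yT; rewrite rpredM. Qed.

(** A factor from [T] can be moved onto [p], which it preserves. *)
Lemma prodset_ideal_extension x y :
  x \in pK -> y \in prodset I T -> x * y \in prodset pK I.
Proof.
move=> xp; apply: (prodset_ind (Q := fun y => x * y \in prodset pK I)).
- by rewrite mulr0 prodset0.
- by move=> u v hu hv; rewrite mulrDr prodsetD.
- move=> u t uI tT; have -> : x * (u * t) = (t * x) * u by ring.
  by rewrite mem_prodset ?multringM.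
Qed.

Lemma prodset_ideal_sub x : x \in prodset pK I -> x \in I.
Proof.
apply: (prodset_ind (Q := fun x => x \in I)); first exact: rpred0.
  by move=> u v; apply: rpredD.
by move=> u v /ideal_in_sub uR vI; apply: fi_stable.
Qed.

Lemma prodset_ideal_eq (J : {pred K}) :
  prodset I T =i J -> prodset pK I =i prodset pK J.
Proof.
move=> IJ x; apply/idP/idP.
  apply: (prodset_ind (Q := fun x => x \in prodset pK J)) => [|u v|u v up vI].
  - exact: prodset0.
  - exact: prodsetD.
  by apply: mem_prodset => //; rewrite -IJ sub_extension.
apply: (prodset_ind (Q := fun x => x \in prodset pK I)) => [|u v|u v up].
- exact: prodset0.
- exact: prodsetD.
by rewrite -IJ; apply: prodset_ideal_extension.
Qed.

Lemma extension_fracideal : exists L : fracideal T, L =i prodset I T.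
Proof.
have zc : zmod_closed (prodset I T).
  split; first exact: prodset0.
  move=> x y hx hy; rewrite prodsetD // -mulN1r; apply: extension_stable hy.
  by rewrite rpredN rpred1.
have lat : lattice (prodset I T).
  have [D D0 Dp] := ideal_in_meets.
  apply: (lattice_between (dedekind_noetherian hZ) (fi_lattice I) (fi_lattice I)
    (oner_neq0 _) D0).
  - exact: prodset0.
  - move=> c x y hx hy; rewrite prodsetD // extension_stable //.
    by apply: sub_multring; apply: order_zemb.
  - by move=> x xI; rewrite rmorph1 mul1r sub_extension.
  - by move=> x hx; apply/prodset_ideal_sub/prodset_ideal_extension.
by exists (FracIdeal zc extension_stable lat).
Qed.

(* If S' is the multiplicator ring of IT then S'p is an ideal of R containing p:
   either it is p, so that S' is contained in T, or it contains 1, and then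
   S' = S'p is contained in R. *)
Lemma colon_extension : colon I I =i R ->
  colon (prodset I T) (prodset I T) =i T.
Proof.
move=> hI; set S' := colon _ _ => s; apply/idP/idP; last first.
  by move=> sT; apply/asboolP => x; apply: extension_stable.
move=> sS'.
have S'M u v : u \in S' -> v \in S' -> u * v \in S'.
  move=> /asboolP hu /asboolP hv; apply/asboolP => x hx.
  by rewrite -mulrA; apply/hu/hv.
have S'p u x : u \in S' -> x \in pK -> u * x \in R.
  move=> /asboolP hu xp; rewrite -hI; apply/asboolP => y yI.
  rewrite [u * x]mulrC -mulrA; apply: prodset_ideal_sub.
  by apply: prodset_ideal_extension => //; apply/hu/sub_extension.
have [h1|h1] := boolP (1 \in prodset S' pK).
  apply: sub_multring; rewrite -[s]mulr1; move: (1) h1.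
  apply: (prodset_ind (Q := fun y => s * y \in R)) => [|u v hu hv|u v uS' vp].
  - by rewrite mulr0 rpred0.
  - by rewrite mulrDr rpredD.
  by rewrite mulrA S'p ?S'M.
have RS' c : c \in R -> c \in S'.
  by move=> cR; apply/asboolP => x; apply: extension_stable; apply: sub_multring.
have [|q qE] := @idealr_of_closed (subring_of R) (fun c => val c \in prodset S' pK).
  split=> //; first exact: prodset0.
  move=> c u v hu hv; rewrite unfold_in (_ : val (c * u + v) = val c * val u + val v) //.
  rewrite prodsetD //; apply: prodsetMl hu => x xS'; apply: S'M => //.
  by apply: RS'; apply: valP.
have pq : {subset p <= q}.
  move=> c cp; rewrite qE unfold_in -[val c]mul1r mem_prodset ?mem_ideal_in //.
  by apply: RS'; apply: rpred1.
apply/asboolP => x xp; have sxR := S'p _ _ sS' xp.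
rewrite -[s * x]/(val (SubringOf sxR : subring_of R)) mem_ideal_in -(hp pq) qE.
by rewrite unfold_in /= mem_prodset.
Qed.

End Extension.
End MultiplicatorRing.

(** * Lifting invertible ideals *)

Section Lifting.
Variables (Z : idomainType) (hZ : dedekind Z) (K : comAlgType {fraction Z}).
Variables (R : subringClosed K) (hR : is_order R).
Variables (p : idealr (subring_of R)) (hp : maximal_ideal p).
Local Notation T := (multring p).
Local Notation pK := (ideal_in p).

Lemma colonL (I J : fracideal T) c x y : c \in T -> x \in colon I J -> y \in colon I J ->
  c * x + y \in colon I J.
Proof.
move=> cT /asboolP hx /asboolP hy; apply/asboolP => z zJ.
by rewrite mulrDl -mulrA rpredD ?hy // fi_stable ?hx.
Qed.

(* With [L = (J : I0 T)] invertible and [x] generating [L] modulo [pL], the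
   ideal [x R + pL] is an invertible lift of [L] to [R], and the required ideal
   is its product [x I0 + pJ] with [I0]. *)
Lemma weak_equiv_lift (I0 : fracideal R) (J I0T : fracideal T) :
    colon I0 I0 =i R -> I0T =i prodset I0 T -> colon J J =i T ->
    weak_equiv I0T J ->
  exists I : fracideal R, [/\ weak_equiv I I0, prodset I T =i J,
    {subset prodset pK J <= I} & {subset I <= J}].
Proof.
move=> hI0 I0TE hJ hw.
have h1 := colon_weak_equiv hZ (multring_order hZ hR hp) (weak_equiv_sym hw).
set L := colon J I0T in h1; set L' := colon I0T J in h1.
have LJ x y : x \in L -> y \in I0T -> x * y \in J by move=> /asboolP h /h.
have L'I x y : x \in L' -> y \in J -> x * y \in I0T by move=> /asboolP h /h.
have LLT x y : x \in L -> y \in L' -> x * y \in T.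
  by move=> xL yL'; rewrite -hJ; apply/asboolP => z zJ; rewrite -mulrA LJ ?L'I.
have colon0 (A B : fracideal T) : 0 \in colon A B.
  by apply/asboolP => z _; rewrite mul0r rpred0.
have [x [x' [xL x'L pip]]] := @semilocal_generator _ T (fun u => u \in pK) L L'
  (rpred0 _) (@ideal_inL _ _ _ p) (multring_power_regular hZ hR hp)
  (colon0 _ _) (@colonL _ _) (colon0 _ _) (@colonL _ _) LLT h1.
set pi := x * x' - 1 in pip.
have RT := @sub_multring _ _ _ p.
have piR : pi \in R by apply: ideal_in_sub pip.
have I0I y : y \in I0 -> y \in I0T by rewrite I0TE; apply: sub_extension.
have pI0 u y : u \in pK -> y \in I0T -> u * y \in I0.
  rewrite I0TE => up hy; apply: prodset_ideal_sub (prodset_ideal_extension up hy).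
have pJstab c y : c \in T -> y \in prodset pK J -> c * y \in prodset pK J.
  by move=> cT; apply: prodsetMl => u; apply: multringM.
have pJJ y : y \in prodset pK J -> y \in J.
  apply: (prodset_ind (Q := fun y => y \in J)); first exact: rpred0.
    by move=> u v; apply: rpredD.
  by move=> u v /ideal_in_sub/RT uT vJ; apply: fi_stable.
pose I : {pred K} := fun y => `[< exists2 i, i \in I0 & y - x * i \in prodset pK J >].
have IP y : y \in I <-> exists2 i, i \in I0 & y - x * i \in prodset pK J.
  by split=> [/asboolP|h]; last exact/asboolP.
have IL c u v : c \in R -> u \in I -> v \in I -> c * u + v \in I.
  move=> cR /IP [i iI hi] /IP [j jI hj]; apply/IP; exists (c * i + j).
    by rewrite rpredD // fi_stable.
  have -> : c * u + v - x * (c * i + j) = c * (u - x * i) + (v - x * j) by ring.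
  by rewrite prodsetD // pJstab ?RT.
have I00 : 0 \in I.
  by apply/IP; exists 0; rewrite ?rpred0 // mulr0 subr0 prodset0.
have pJI y : y \in prodset pK J -> y \in I.
  by move=> hy; apply/IP; exists 0; rewrite ?rpred0 // mulr0 subr0.
have xI0 i : i \in I0 -> x * i \in I.
  by move=> hi; apply/IP; exists i => //; rewrite subrr prodset0.
have IJ y : y \in I -> y \in J.
  by move=> /IP [i /I0I iI /pJJ h]; rewrite -(subrK (x * i) y) rpredD ?LJ.
have Izc : zmod_closed I.
  by split=> // u v uI vI; rewrite addrC -mulN1r IL // rpredN rpred1.
have Ist c u : c \in R -> u \in I -> c * u \in I.
  by move=> cR uI; rewrite -[c * u]addr0 IL.
have Ilat : lattice I.
  have [D D0 Dp] := ideal_in_meets hZ hR hp.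
  apply: (lattice_between (dedekind_noetherian hZ) (fi_lattice J) (fi_lattice J)
    D0 (oner_neq0 _)) => //.
  - by move=> c u v uI vI; rewrite IL // order_zemb.
  - by move=> u uJ; apply: pJI; apply: mem_prodset.
  - by move=> u /IJ uJ; rewrite rmorph1 mul1r.
have L'pI u y : u \in pK -> y \in L' -> u * y \in colon I0 I.
  move=> up yL'; apply/asboolP => z /IJ zJ.
  by rewrite -mulrA pI0 // L'I.
exists (FracIdeal Izc Ist Ilat); split=> //=; last first.
  move=> y; apply/idP/idP.
    apply: (prodset_ind (Q := fun y => y \in J)); first exact: rpred0.
      by move=> u v; apply: rpredD.
    by move=> u v /IJ uJ vT; rewrite mulrC fi_stable.
  (* [x' * y] lies in [I0 T], and the correction [pi * y] in [pJ]. *)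
  move=> yJ; have -> : y = x * (x' * y) + - (pi * y) by rewrite /pi; ring.
  apply: prodsetD.
    have : x' * y \in prodset I0 T by rewrite -I0TE L'I.
    apply: (prodset_ind (Q := fun z => x * z \in prodset I T)) => [|u v hu hv|u v uI vT].
    - by rewrite mulr0 prodset0.
    - by rewrite mulrDr prodsetD.
    - by rewrite mulrA mem_prodset ?xI0.
  rewrite -mulNr -[_ * y]mulr1 mem_prodset ?rpred1 //; apply: pJI.
  by rewrite mem_prodset ?rpredN.
apply: weak_equiv_colon => //.
(* [x' * x = 1 + pi] lies in [R], and [x'] carries [pJ] into [p (I0 T)], which is inside [I0]. *)
have x'colon : x' \in colon I0 I.
  apply/asboolP => z /IP [i iI hz].
  have -> : x' * z = (1 + pi) * i + x' * (z - x * i) by rewrite /pi; ring.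
  rewrite rpredD //; first by rewrite fi_stable // rpredD ?rpred1.
  move: (z - x * i) hz.
  apply: (prodset_ind (Q := fun w => x' * w \in I0)) => [|u v hu hv|u v up vJ].
  - by rewrite mulr0 rpred0.
  - by rewrite mulrDr rpredD.
  - by rewrite mulrCA pI0 // L'I.
have xcolon c : c \in R -> c * x \in colon I I0.
  by move=> cR; apply/asboolP => i iI; rewrite -mulrA Ist ?xI0.
have pLcolon u y : u \in pK -> y \in L -> u * y \in colon I I0.
  move=> up yL; apply/asboolP => i /I0I iI; apply: pJI.
  by rewrite -mulrA mem_prodset // LJ.
(* As [x * x' = 1 + pi], the first term is [1 - pi^2]. The other is [pi^2 * 1] with 1 in [L L'], so
   it lies in [(pL)(pL')]. *)
have -> : 1 = (1 - pi) * x * x' + pi * pi by rewrite /pi; ring.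
apply: prodsetD.
  by apply: mem_prodset => //; apply: xcolon; rewrite rpredB ?rpred1.
rewrite -[X in X \in _]mulr1; move: (1) h1.
apply: (prodset_ind (Q := fun w => pi * pi * w \in prodset (colon I I0) (colon I0 I))).
- by rewrite mulr0 prodset0.
- by move=> u v hu hv; rewrite mulrDr prodsetD.
move=> u v uL vL'; have -> : pi * pi * (u * v) = (pi * u) * (pi * v) by ring.
by apply: mem_prodset; [apply: pLcolon | apply: L'pI].
Qed.

(** The colon criterion passes from [R] to [T], because [u B <= A] implies [u BT <= AT]. This yields
    uniqueness of the index. *)
Lemma weak_equiv_extension (I I' : fracideal R) (J J' : fracideal T) :
    prodset I T =i J -> prodset I' T =i J' -> colon J' J' =i T ->
    weak_equiv I I' -> weak_equiv J J'.
Proof.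
move=> IJ IJ' hJ' hw; apply: weak_equiv_colon => //.
have ext (A B : fracideal R) (C D : fracideal T) u : prodset A T =i C ->
    prodset B T =i D -> u \in colon A B -> u \in colon C D.
  move=> eA eB /asboolP hu; apply/asboolP => y; rewrite -eA -eB.
  apply: (prodset_ind (Q := fun y => u * y \in prodset A T)) => [|a b ha hb|a b aB bT].
  - by rewrite mulr0 prodset0.
  - by rewrite mulrDr prodsetD.
  - by rewrite mulrA mem_prodset ?hu.
move: (1) (colon_weak_equiv hZ hR hw).
apply: (prodset_ind (Q := fun y => y \in prodset (colon J J') (colon J' J))).
- exact: prodset0.
- by move=> u v; apply: prodsetD.
- by move=> u v uI vI; apply: mem_prodset; [apply: (ext I I') | apply: (ext I' I)].
Qed.

End Lifting.

Theorem theorem6p3 (Z : idomainType) (hZ : dedekind Z)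
    (K : comAlgType {fraction Z}) (hK : etale K)
    (R : subringClosed K) (hR : is_order R)
    (p : idealr (subring_of R)) (hp : maximal_ideal p)
    (n : nat) (J : 'I_n -> fracideal (multring p))
    (hJmult : forall i, colon (J i) (J i) =i multring p)
    (hJdistinct : forall i j, weak_equiv (J i) (J j) -> i = j)
    (hJall : forall L : fracideal (multring p),
       colon L L =i multring p -> exists i, weak_equiv L (J i))
    (I0 : fracideal R) (hI0 : colon I0 I0 =i R) :
  let good (I : fracideal R) (i : 'I_n) : Prop :=
    [/\ weak_equiv I I0,
        prodset I (multring p) =i J i,
        prodset (ideal_in p) I =i prodset (ideal_in p) (J i),
        {subset prodset (ideal_in p) (J i) <= I} &
        {subset I <= J i}] in
  (exists! i : 'I_n, exists I : fracideal R, good I i) /\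
  (forall (I : fracideal R) (i : 'I_n), good I i ->
     exists f : {linear mod_ideal p (fi_elt I) ->
                        mod_ideal p (fi_elt (fi_restrict (sub_multring p) (J i)))},
       (forall (x : fi_elt I)
               (y : fi_elt (fi_restrict (sub_multring p) (J i))),
          fi_val x = fi_val y -> f (mod_cls p x) = mod_cls p y) /\
       injective f).
Proof.
move=> good; split.
  have [I0T I0TE] := extension_fracideal hZ hR hp I0.
  have I0Tc : colon I0T I0T =i multring p.
    move=> s; rewrite -(colon_extension hp hI0).
    by apply/asboolP/asboolP => h x; have := h x; rewrite !I0TE.
  have [i hi] := hJall _ I0Tc.
  have [I [II0 IT pJI IJ]] :=
    weak_equiv_lift hZ hR hp hI0 I0TE (hJmult i) hi.
  exists i; split.
    by exists I; split=> //; apply: prodset_ideal_eq.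
  move=> j [I' [I'I0 I'T _ _ _]]; apply: hJdistinct.
  apply: (weak_equiv_extension hZ hR IT I'T (hJmult j)).
  exact: weak_equiv_trans II0 (weak_equiv_sym I'I0).
move=> I i [_ _ pIJ _ IJ].
exact: mod_ideal_inclusion.
Qed.
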